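(* Consider a smooth slow-fast Liénard family, near $(x,y)=(0,0)$ and for $\epsilon\ge 0$, $(\epsilon,\lambda)\sim(0,\lambda_0)\in\mathbb R\times\mathbb R^l$, $$\dot x=y-x^2+x^3h_1(x,\epsilon,\lambda),\qquad \dot y=\epsilon\big(b(\epsilon,\lambda)-x\big),$$ where $h_1,b$ are smooth and $b(0,\lambda_0)=0$. 1. If the family has finite (traditional) codimension $j+1\ge1$ at $(\epsilon,\lambda)=(0,\lambda_0)$, i.e. $h_1(x,0,\lambda_0)+h_1(-x,0,\lambda_0)=\alpha x^{2j}+O(x^{2j+2})$ with $\alpha\neq0$ for some $j\in\mathbb N_0$, then the fractal codimension of the contact point $(0,0)$ for $\lambda=\lambda_0$ is finite and equal to $j+1$. 2. If the family has infinite (traditional) codimension, i.e. no such $j\in\mathbb N_0$ exists, and if the slow divergence integral $I$ has no zeros on $\sigma_1$ for $\sigma_1$ sufficiently close to the origin (so that the fractal codimension is defined), then the fractal codimension of $(0,0)$ for $\lambda=\lambda_0$ is infinite.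
   Context: Smooth means $C^\infty$ and $\mathbb N_0=\{0,1,2,\dots\}$. The fractal codimension is defined as follows, for the family above at $\epsilon=0$, $\lambda=\lambda_0$. Let $F(x)=x^2-x^3h_1(x,0,\lambda_0)$; the critical curve is $\{y=F(x)\}$ near the origin, normally attracting for $x>0$ and normally repelling for $x<0$. The fast orbits are horizontal, and the slow dynamics points from the attracting to the repelling branch. The contact order is $2$ and the singularity order is $1$. Let $\sigma=\sigma_1\cup\{(0,0)\}\cup\sigma_2$ be a smooth curve through the origin, in a small neighborhood of it, transverse to the horizontal lines, with $\sigma_1$ the part in $\{y>0\}$, lying in the region $y>F(x)$ inside the critical curve. For $\tilde p\in\sigma_1$ with second coordinate $y$, let $\alpha(\tilde p)<0<\omega(\tilde p)$ be the small solutions $x$ of $F(x)=y$. For $\tilde p,\bar p\in\sigma_1$ define the slow divergence integral $$I(\tilde p,\bar p)=\int_{\alpha(\tilde p)}^{\omega(\bar p)}\frac{F'(x)^2}{x}\,dx,\qquad I(\tilde p)=I(\tilde p,\tilde p).$$ The definition requires that $I(\tilde p)\neq0$ for all $\tilde p\in\sigma_1$ (for $\sigma_1$ small); then $I$ has constant sign on $\sigma_1$. For $p_0\in\sigma_1$ let $(p_k)_{k\ge0}\subset\sigma_1$ be defined recursively by $I(p_{k+1},p_k)=0$ if $I<0$ on $\sigma_1$, and by $I(p_k,p_{k+1})=0$ if $I>0$ on $\sigma_1$; it converges monotonically to the origin. Put $\mathcal S=\{p_k\mid k\ge0\}$. Minkowski dimension: for bounded $A\subset\mathbb R^2$ with Euclidean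 $\varepsilon$-neighborhood $A_\varepsilon$, let $\overline{\mathcal M}^r(A)$, $\underline{\mathcal M}^r(A)$ be the $\limsup$, $\liminf$ of $|A_\varepsilon|/\varepsilon^{2-r}$ as $\varepsilon\to0^+$ ($|\cdot|$ is Lebesgue measure). If $\inf\{r\ge0:\overline{\mathcal M}^r(A)=0\}=\inf\{r\ge0:\underline{\mathcal M}^r(A)=0\}$, the common value is $\dim_BA$. The dimension $\dim_B\mathcal S$ exists and does not depend on $\sigma$ or $p_0$. Fractal codimension: if $\dim_B\mathcal S<1$, the fractal codimension is finite and equal to $i+1$ with $i=\frac{3\dim_B\mathcal S-1}{2(1-\dim_B\mathcal S)}\in\mathbb N_0$. If $\dim_B\mathcal S=1$, it is infinite. *)

(* Defs.v *)
From mathcomp Require Import all_boot all_order all_algebra.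
From mathcomp Require Import all_classical all_reals all_analysis.
From mathcomp Require Import ring lra.

Set Implicit Arguments.
Unset Strict Implicit.
Unset Printing Implicit Defensive.

Import Order.TTheory GRing.Theory Num.Theory.
Import numFieldNormedType.Exports.

Local Open Scope classical_set_scope.
Local Open Scope ring_scope.

Section Smoothness.
Context {R : realType}.

(* f is of class C^k on the open set U: all directional derivatives of order
   at most k exist on U and are continuous there; over a finite-dimensional V
   this is the usual notion. *)
Fixpoint Ck_on {V W : normedModType R} (k : nat) (U : set V) (f : V -> W)
    : Prop :=
  (forall x, U x -> {for x, continuous f}) /\
  (if k is k'.+1 then
     forall v, (forall x, U x -> derivable f x v) /\
               Ck_on k' U (fun x => 'D_v f x)
   else True).

Definition smooth_on {V W : normedModType R} (U : set V) (f : V -> W) : Prop :=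
  forall k, Ck_on k U f.

(* Smoothness near p of a function of which only the values on D matter: near
   p it is the restriction to D of a smooth function defined on an open set.
   For D a half-space this is smoothness up to the boundary. *)
Definition smooth_near {V W : normedModType R} (D : set V) (f : V -> W) (p : V)
    : Prop :=
  exists (U : set V) (g : V -> W),
    [/\ open U, U p, smooth_on U g & forall q, U q -> D q -> f q = g q].

End Smoothness.

Section Family.
Context {R : realType} {l : nat}.

(* The parameter eps ranges over eps >= 0. *)
Definition smooth_h1 (h1 : R -> R -> 'rV[R]_l -> R) (lam0 : 'rV[R]_l) : Prop :=
  smooth_near (W := R^o)
    [set q : R^o * R^o * 'rV[R]_l | 0 <= q.1.2]
    (fun q => h1 q.1.1 q.1.2 q.2) (0, 0, lam0).

Definition smooth_b (b : R -> 'rV[R]_l -> R) (lam0 : 'rV[R]_l) : Prop :=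
  smooth_near (W := R^o)
    [set q : R^o * 'rV[R]_l | 0 <= q.1] (fun q => b q.1 q.2) (0, lam0).

Definition lienard_field (h1 : R -> R -> 'rV[R]_l -> R) (b : R -> 'rV[R]_l -> R)
    (eps : R) (lam : 'rV[R]_l) (p : R * R) : R * R :=
  (p.2 - p.1 ^+ 2 + p.1 ^+ 3 * h1 p.1 eps lam, eps * (b eps lam - p.1)).

Definition critical_fun (h1 : R -> R -> 'rV[R]_l -> R) (lam0 : 'rV[R]_l)
    (x : R) : R := x ^+ 2 - x ^+ 3 * h1 x 0 lam0.

Lemma critical_curveP (h1 : R -> R -> 'rV[R]_l -> R) (b : R -> 'rV[R]_l -> R)
    (lam0 : 'rV[R]_l) (p : R * R) :
  lienard_field h1 b 0 lam0 p = (0, 0) <-> p.2 = critical_fun h1 lam0 p.1.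
Proof.
rewrite /lienard_field /critical_fun mul0r; set x := p.1; set y := p.2.
set h := h1 x 0 lam0.
have -> : y - x ^+ 2 + x ^+ 3 * h = y - (x ^+ 2 - x ^+ 3 * h) by ring.
by split=> [[/eqP]|->]; rewrite ?subrr// subr_eq0 => /eqP.
Qed.

End Family.

Section TraditionalCodimension.
Context {R : realType} {l : nat}.

Definition even_part_order (h1 : R -> R -> 'rV[R]_l -> R) (lam0 : 'rV[R]_l)
    (j : nat) : Prop :=
  exists2 alpha : R, alpha != 0 &
    (fun x : R^o => h1 x 0 lam0 + h1 (- x) 0 lam0 - alpha * x ^+ (2 * j) : R^o)
      =O_ (0 : R^o) (fun x : R^o => x ^+ (2 * j + 2) : R^o).

Definition finite_codim (h1 : R -> R -> 'rV[R]_l -> R) (lam0 : 'rV[R]_l)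
    (n : nat) : Prop :=
  exists2 j, n = j.+1 & even_part_order h1 lam0 j.

Definition infinite_codim (h1 : R -> R -> 'rV[R]_l -> R) (lam0 : 'rV[R]_l)
    : Prop :=
  ~ exists j, even_part_order h1 lam0 j.

End TraditionalCodimension.

Section MinkowskiDimension.
Context {R : realType}.
Local Open Scope ereal_scope.

Definition euclidean_nbhd (A : set (R * R)) (e : R) : set (R * R) :=
  [set q | exists2 a, A a &
     (Num.sqrt ((q.1 - a.1) ^+ 2 + (q.2 - a.2) ^+ 2) < e)%R].

Definition area : set (R * R) -> \bar R :=
  (@lebesgue_measure R \x @lebesgue_measure R).

Definition content_ratio (r : R) (A : set (R * R)) (e : R) : \bar R :=
  area (euclidean_nbhd A e) * ((e `^ (2 - r))^-1)%:E.

Definition upper_content (r : R) (A : set (R * R)) : \bar R :=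
  limf_esup (content_ratio r A) 0^'+.

Definition lower_content (r : R) (A : set (R * R)) : \bar R :=
  limf_einf (content_ratio r A) 0^'+.

Definition upper_box_dim (A : set (R * R)) : \bar R :=
  ereal_inf [set r%:E | r in [set r | (0 <= r)%R /\ upper_content r A = 0]].

Definition lower_box_dim (A : set (R * R)) : \bar R :=
  ereal_inf [set r%:E | r in [set r | (0 <= r)%R /\ lower_content r A = 0]].

Definition has_box_dim (A : set (R * R)) (d : R) : Prop :=
  upper_box_dim A = d%:E /\ lower_box_dim A = d%:E.

End MinkowskiDimension.

Section FractalCodimension.
Context {R : realType}.
Implicit Types (F : R -> R) (sigma : set (R * R)) (p q : R * R).

(* A smooth curve through the origin, nowhere tangent to the horizontal lines,
   whose part in the upper half-plane lies inside the critical curve. *)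
Definition transverse_section F sigma : Prop :=
  exists (a : R) (gamma : R^o -> R^o * R^o),
    [/\ 0 < a,
        smooth_on (`]- a, a[ : set R^o) gamma,
        gamma 0 = (0, 0),
        (forall t, - a < t < a -> (derive1 gamma t).2 != 0) &
        sigma = gamma @` `]- a, a[] /\
    (forall p, sigma p -> 0 < p.2 -> F p.1 < p.2).

(* The part of sigma in the upper half-plane, cut at height rho; shrinking
   sigma_1 towards the origin amounts to letting rho tend to 0. *)
Definition upper_part sigma (rho : R) : set (R * R) :=
  [set p | sigma p /\ 0 < p.2 < rho].

(* The solutions x of F x = y closest to 0 on either side. For F x ~ x^2 and
   small y > 0 these are the two small solutions. *)
Definition omega_pt F (y : R) : R := inf [set x | 0 < x /\ F x = y].
Definition alpha_pt F (y : R) : R := sup [set x | x < 0 /\ F x = y].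

(* The integrand extends continuously by 0 at x = 0, and division by 0 gives
   0 here. *)
Definition slow_divergence F p q : R :=
  \int[@lebesgue_measure R]_(x in `[alpha_pt F p.2, omega_pt F q.2])
    (derive1 F x ^+ 2 / x).

Definition divergence_nonzero F (sigma1 : set (R * R)) : Prop :=
  forall p, sigma1 p -> slow_divergence F p p != 0.

Definition slow_orbit F (sigma1 : set (R * R)) (p0 : R * R)
    (s : nat -> R * R) : Prop :=
  [/\ s 0%N = p0,
      (forall k, sigma1 (s k)) &
      ((forall q, sigma1 q -> slow_divergence F q q < 0) /\
       (forall k, slow_divergence F (s k.+1) (s k) = 0)) \/
      ((forall q, sigma1 q -> 0 < slow_divergence F q q) /\
       (forall k, slow_divergence F (s k) (s k.+1) = 0))].

(* None stands for infinite codimension. *)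
Definition codim_of_dim (d : R) (c : option nat) : Prop :=
  match c with
  | Some n => d < 1 /\
      exists i : nat, n = i.+1 /\ i%:R = (3 * d - 1) / (2 * (1 - d))
  | None => d = 1
  end.

(* The fractal codimension of the contact point exists and equals c: for every
   section sigma and every small sigma_1, the integral I has no zeros on
   sigma_1, an orbit starts at each p0 of sigma_1, and its box dimension exists
   and yields the value c, whatever sigma and p0. *)
Definition fractal_codim F (c : option nat) : Prop :=
  forall sigma, transverse_section F sigma ->
  \forall rho \near (0 : R)^'+,
    divergence_nonzero F (upper_part sigma rho) /\
    forall p0, upper_part sigma rho p0 ->
      (exists s, slow_orbit F (upper_part sigma rho) p0 s) /\
      (forall s, slow_orbit F (upper_part sigma rho) p0 s ->
         exists2 d, has_box_dim (range s) d & codim_of_dim d c).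

End FractalCodimension.

(* Main.v *)
(* Write F' = x G, with G close to 2, and let P be a primitive of F'^2 / x, so
   that P' = G F'. Put D(x) = F(x) - F(-x) = -x^3 (h(x) + h(-x)). At height y,
   with z = -alpha(y), integration by parts of P(x) - P(-x), whose derivative is
   D'(x) (G(x) + G(-x)), shows that P(z) - P(-z) is about 4 D(z), while
   P(omega) - P(z) is about 2 (F(omega) - F(z)) = -2 D(z); so I(y) is about
   2 D(z). Hence |I(y)| is comparable to y^mu with mu = j + 3/2 in codimension
   j + 1, and is O(y^N) for every N in infinite codimension. The heights y_k of
   the slow orbit have gaps y_k - y_{k+1} comparable to |I(y_k)|, and the orbit
   lies on a Lipschitz graph over the y-axis, so by Fubini the area of its
   e-neighborhood is comparable to e times the length of the e-neighborhood of
   {y_k}. The latter is of order e^(1/mu), which yields the dimension 1 - 1/mu,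
   and 1 in the flat case. *)

Require Import Defs.
From mathcomp Require Import all_boot all_order all_algebra.
From mathcomp Require Import all_classical all_reals all_analysis.
From mathcomp Require Import measurable_realfun ring lra.

Set Implicit Arguments.
Unset Strict Implicit.
Unset Printing Implicit Defensive.

Import Order.TTheory GRing.Theory Num.Theory.
Import numFieldNormedType.Exports.

Local Open Scope classical_set_scope.
Local Open Scope ring_scope.

(** * Calculus *)

(** The integration by parts leaves a remainder: up to sign, the integral of [D(x) (G'(x) - G'(-x))]
    over [[0, z]]. It is controlled only by [z] times a bound of |D| on the whole interval, so [D]
    has to be estimated there and not just at [z]. Confining [G] to [[3/2, 5/2]] is what makes the
    main term win: the two approximations by [-2 D(z)] and [4 D(z)] cost |D(z)|/2 and |D(z)|, a
    total of 3/2, which stays below the coefficient 2. The branches [omega] and [alpha] behave like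
    square roots of the height at the contact point. They are never differentiated: the two halves
    of the integral are treated as functions [J] and [L] of the height, whose difference quotients
    lie in [[3/2, 5/2]]. As these involve the height alone, one pair serves all sections, and
    nonvanishing of [I] on one section carries over to every other. In the flat case the gaps have
    no lower bound by a power. There the dimension is at most 1 because the orbit lies on a
    Lipschitz graph, and at least 1 because the gaps are smaller than every power. *)

Lemma mean_value {R : realType} (f df : R -> R) (a b : R) : a <= b ->
  (forall x, a <= x <= b -> is_derive x 1 f (df x)) ->
  exists2 c, a <= c <= b & f b - f a = df c * (b - a).
Proof.
move=> ab fdf; have [||c cab ->] := @MVT_segment R f df a b ab.
- by move=> x /[!in_itv]/= /andP[ax xb]; apply: fdf; rewrite !ltW.
- apply: derivable_within_continuous => x /[!in_itv]/= xab.
  by have [] := fdf _ xab.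
- by exists c.
Qed.

Lemma intermediate_value {R : realType} (f : R -> R) (a b v : R) : a <= b ->
  (forall x, a <= x <= b -> {for x, continuous f}) ->
  (f a <= v <= f b) || (f b <= v <= f a) ->
  exists2 c, a <= c <= b & f c = v.
Proof.
move=> ab fc vab; have [||c cab <-] := @IVT R f a b v ab.
- apply/continuous_in_subspaceT => x; rewrite inE/= in_itv/=; exact: fc.
- rewrite ge_min le_max; case/orP: vab => /andP[-> ->] //; by rewrite !orbT.
- by exists c.
Qed.

(** The line [eps = 0] lies in the half-space where [h1] agrees with its smooth extension [g]; [H k]
    is the k-th derivative of [g] in the direction of x along it. *)
Lemma smooth_slice {R : realType} {l : nat} (h1 : R -> R -> 'rV[R]_l -> R)
    (lam0 : 'rV[R]_l) : smooth_h1 h1 lam0 ->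
  exists2 a : R, 0 < a & exists2 H : nat -> R -> R,
    (forall x, `|x| < a -> H 0%N x = h1 x 0 lam0) &
    (forall k (x : R), `|x| < a -> is_derive x (1 : R) (H k) (H k.+1 x)).
Proof.
case=> U [g [oU U0 sg gh]].
pose v : R^o * R^o * 'rV[R]_l := (1, 0, 0).
pose Dg n : R^o * R^o * 'rV[R]_l -> R^o := iter n (fun f x => 'D_v f x) g.
pose e (x : R) : R^o * R^o * 'rV[R]_l := (x, 0, lam0).
have sDg n k : Ck_on k U (Dg n).
  elim: n k => [|n IH] k; first exact: sg.
  by have /= [_ /(_ v) []] := IH k.+1.
have [a a0 aU] : exists2 a : R, 0 < a & forall x, `|x| < a -> U (e x).
  have /nbhs_ballP[a /= a0 aU] : nbhs (e 0) U by apply: open_nbhs_nbhs; split.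
  exists a => // x xa; apply: aU; split; first split => /=.
  - by rewrite /ball/= sub0r normrN.
  - exact: ballxx.
  - exact: ballxx.
exists a => //; exists (fun n x => Dg n (e x)) => [x xa|k x xa].
  by apply: esym; apply: (gh (e x)) => //=; exact: aU.
have [_ /(_ v) [dD _]] := sDg k 1%N.
(* The difference quotient along the line is the one defining the derivative of [Dg k] in the
   direction [v]. *)
have E : (fun h : R => h^-1 *: ((Dg k \o e) (h *: (1:R) + x) - Dg k (e x))) =
     (fun h : R => h^-1 *: (Dg k (h *: v + e x) - Dg k (e x))).
  apply/funext => h /=; congr (_ *: (Dg k _ - _)).
  rewrite /e /v; congr (_, _, _) => /=.
  + by rewrite /= scaler0 addr0.
  + by rewrite scaler0 add0r.
have dDx := dD _ (aU _ xa).
apply: DeriveDef.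
- by rewrite /derivable /= E.
- by rewrite /derive /= E.
Qed.

(** * Transverse sections *)

Lemma cvg_pair_components {R : realType} (F : set_system R) {FF : Filter F}
    (f : R -> R^o * R^o) (l : R^o * R^o) :
  f x @[x --> F] --> l ->
  (fun x => (f x).1 : R) @ F --> (l.1 : R) /\
  (fun x => (f x).2 : R) @ F --> (l.2 : R).
Proof.
move=> fl; split.
- exact: (@cvg_comp _ _ _ f fst F (nbhs l) (nbhs l.1) fl (@cvg_fst _ _ (nbhs l.1) (nbhs l.2) _)).
- exact: (@cvg_comp _ _ _ f snd F (nbhs l) (nbhs l.2) fl (@cvg_snd _ _ (nbhs l.1) (nbhs l.2) _)).
Qed.

Lemma is_derive_components {R : realType} (gamma : R^o -> R^o * R^o) (t : R) :
  derivable gamma t 1 ->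
  is_derive t (1:R) (fun x : R => (gamma x).1 : R) (derive1 gamma t).1 /\
  is_derive t (1:R) (fun x : R => (gamma x).2 : R) (derive1 gamma t).2.
Proof.
move=> dg; have : (fun h : R => h^-1 *: (gamma (h *: 1 + t) - gamma t)) @ 0^'
    --> (derive1 gamma t : R^o * R^o) by rewrite derive1E.
move=> /cvg_pair_components[] c1 c2.
split; apply: DeriveDef.
- by apply/cvg_ex; exists (derive1 gamma t).1.
- exact: cvg_lim c1.
- by apply/cvg_ex; exists (derive1 gamma t).2.
- exact: cvg_lim c2.
Qed.

Lemma smooth_curve_components {R : realType} (a : R) (gamma : R^o -> R^o * R^o) :
  smooth_on (`]- a, a[ : set R^o) gamma ->
  forall t : R, - a < t < a ->
  [/\ is_derive t (1:R) (fun x : R => (gamma x).1 : R) (derive1 gamma t).1,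
      is_derive t (1:R) (fun x : R => (gamma x).2 : R) (derive1 gamma t).2,
      {for t, continuous (fun x : R => (derive1 gamma x).1 : R)} &
      {for t, continuous (fun x : R => (derive1 gamma x).2 : R)}].
Proof.
move=> sg t ta; have tI : [set` `]- a, a[] t by rewrite /= in_itv.
have [_ /(_ 1)[dg [cg _]]] := sg 1%N.
have [? ?] := is_derive_components (dg _ tI).
have E : (fun x : R^o => 'D_1 gamma x) = derive1 gamma.
  by apply/funext => x; rewrite derive1E.
have {}cg : (derive1 gamma) x @[x --> t] --> derive1 gamma t.
  by rewrite -E; exact: cg.
have [c1 c2] := cvg_pair_components cg.
by split.
Qed.

Lemma nonzero_constant_sign {R : realType} (f : R -> R) (a : R) : 0 < a ->
  (forall t, - a < t < a -> {for t, continuous f}) ->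
  (forall t, - a < t < a -> f t != 0) ->
  forall t, - a < t < a -> 0 < Num.sg (f 0) * f t.
Proof.
move=> a0 cf f0 t ta.
have f00 : f 0 != 0 by apply: f0; lra.
have ft0 := f0 _ ta.
have zero u v : - a < u < a -> - a < v < a -> f u < 0 -> 0 < f v -> False.
  move=> ua va fu fv; have [uv|vu] := leP u v.
  - have [||c /andP[uc cv] fc] := @intermediate_value R f u v 0 uv.
    + by move=> x /andP[ux xv]; apply: cf; lra.
    + by rewrite (ltW fu) (ltW fv).
    + by have : f c != 0 by [apply: f0; lra]; rewrite fc eqxx.
  - have [||c /andP[uc cv] fc] := @intermediate_value R f v u 0 (ltW vu).
    + by move=> x /andP[ux xv]; apply: cf; lra.
    + by rewrite (ltW fu) (ltW fv) orbT.
    + by have : f c != 0 by [apply: f0; lra]; rewrite fc eqxx.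
have Ia : - a < (0 : R) < a by lra.
case: (ltgtP (f 0) 0) f00 => // f00 _; last first.
  rewrite gtr0_sg// mul1r; case: (ltgtP (f t) 0) ft0 => // ft _.
  by have := zero _ _ ta Ia ft f00.
rewrite ltr0_sg// mulN1r oppr_gt0; case: (ltgtP (f t) 0) ft0 => // ft _.
by have := zero _ _ Ia ta f00 ft.
Qed.

(** Since [d2] keeps its sign on the whole of []- a, a[], the height is strictly monotone there, so
    points at heights below [rho] come only from parameters in [[- t0, t0]], where [d1] is bounded
    and [d2] is bounded away from 0. The sign [s] makes [u = s * g2] increasing for either
    orientation of the curve. *)
Lemma monotone_height_lipschitz {R : realType} (a : R) (g1 g2 d1 d2 : R -> R) :
  0 < a -> g2 0 = 0 ->
  (forall t : R, - a < t < a ->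
    [/\ is_derive t (1:R) g1 (d1 t), is_derive t (1:R) g2 (d2 t),
        {for t, continuous d1} & {for t, continuous d2}]) ->
  (forall t, - a < t < a -> d2 t != 0) ->
  exists2 rho : R, 0 < rho & exists2 K : R, 0 <= K &
    (forall y, 0 < y < rho -> exists2 t, - a < t < a & g2 t = y) /\
    (forall t t', - a < t < a -> 0 < g2 t < rho -> - a < t' < a ->
      0 < g2 t' < rho -> `|g1 t - g1 t'| <= K * `|g2 t - g2 t'|).
Proof.
move=> a0 g0 comp dg0.
have Ia : - a < (0 : R) < a by lra.
pose s := Num.sg (d2 0).
have sd2 : forall t, - a < t < a -> 0 < s * d2 t.
  by apply: nonzero_constant_sign => // t /comp[].
have s2 : s * s = 1.
  by rewrite -expr2 sqr_sg (dg0 _ Ia).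
have d20 := sd2 _ Ia.
have [t0 t00 Ht0] : exists2 t0 : R, 0 < t0 & t0 < a /\
    forall t, `|t| <= t0 -> `|d1 t| <= `|d1 0| + 1 /\ s * d2 0 / 2 <= s * d2 t.
  have [_ _ c1 c2] := comp _ Ia.
  have c3 : (fun x => s * d2 x) @ (0:R) --> s * d2 0 by apply: cvgMr.
  have : \forall t \near (0:R), `|d1 0 - d1 t| < 1 /\ `|s * d2 0 - s * d2 t| < s * d2 0 / 2.
    near=> t; split; near: t.
    - by move/cvgrPdist_lt : c1; apply; rewrite ltr01.
    - by move/cvgrPdist_lt : c3; apply; lra.
  move=> /nbhs_ballP[e /= e0 He].
  exists (Num.min (e / 2) (a / 2)); first by rewrite lt_min; apply/andP; split; lra.
  split; first by rewrite gt_min; apply/orP; right; lra.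
  move=> t; rewrite le_min => /andP[te ta].
  have [|h1 h2] := He t; first by rewrite /ball/= sub0r normrN; lra.
  split; last by move: h2; rewrite ltr_norml => /andP[_]; lra.
  by have := ler_normB (d1 0) (d1 0 - d1 t); rewrite opprB addrC subrK; lra.
case: Ht0 => t0a Ht0.
pose u t := s * g2 t.
have du t : - a < t < a -> is_derive t (1:R) u (s * d2 t).
  move=> /comp[_ d _ _]; rewrite /u.
  have -> : (fun t : R => s * g2 t) = s \*: g2 by [].
  exact: is_deriveZ.
have umono x y : - a < x < a -> - a < y < a -> x <= y -> u x <= u y.
  move=> xa ya xy; have [|c /andP[xc cy] E] := @mean_value R u (fun t => s * d2 t) x y xy.
    by move=> z /andP[xz zy]; apply: du; lra.
  by rewrite -subr_ge0 E mulr_ge0 ?subr_ge0// ltW// sd2//; lra.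
have u0 : u 0 = 0 by rewrite /u g0 mulr0.
have ustrict x y : - a < x < a -> - a < y < a -> x < y -> u x < u y.
  move=> xa ya xy; have [|c /andP[xc cy] E] := @mean_value R u (fun t => s * d2 t) x y (ltW xy).
    by move=> z /andP[xz zy]; apply: du; lra.
  by rewrite -subr_gt0 E mulr_gt0 ?subr_gt0// sd2//; lra.
pose rho := Num.min (u t0) (- u (- t0)).
have ru1 : rho <= u t0 by rewrite /rho ge_min lexx.
have ru2 : u (- t0) <= - rho by rewrite lerNr /rho ge_min lexx orbT.
have g2u t : g2 t = s * u t by rewrite /u mulrA s2 mul1r.
have s1 : s = 1 \/ s = - 1.
  by rewrite /s; case: sgrP d20 => //; [move=> ->; rewrite mulr0 ltxx|left|right].
exists rho.
  rewrite lt_min oppr_gt0 -u0; apply/andP; split; apply: ustrict; lra.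
(* The bound of |d1| over the lower bound of [s * d2] on [[- t0, t0]]: with it [K * u - e * g1] is
   nondecreasing for both signs [e], which gives the Lipschitz bound. *)
pose K := (`|d1 0| + 1) / (s * d2 0 / 2).
have K0 : 0 <= K by rewrite divr_ge0 ?addr_ge0// ltW//; lra.
exists K => //; split.
  move=> y /andP[y0 yr].
  have [|||c cI Hc] := @intermediate_value R g2 (- t0) t0 y.
  - lra.
  - move=> x /andP[x1 x2].
    have [|_ d _ _] := comp x; first by lra.
    exact/differentiable_continuous/derivable1_diffP/ex_derive.
  - rewrite !g2u; case: s1 => ->; rewrite ?mul1r ?mulN1r; apply/orP; [left|right]; apply/andP; split; lra.
  - exists c => //; lra.
have inside t : - a < t < a -> 0 < g2 t < rho -> - t0 <= t <= t0.
  move=> ta; rewrite g2u => /andP[p1 p2].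
  have lo : - rho < u t < rho by case: s1 p1 p2 => ->; rewrite ?mul1r ?mulN1r; lra.
  apply/andP; split; rewrite leNgt; apply/negP => tt.
  - have : u t <= u (- t0) by apply: umono => //; [lra|exact: ltW].
    lra.
  - have : u t0 <= u t by apply: umono => //; [lra|exact: ltW].
    lra.
have lip x y : - t0 <= x -> x <= y -> y <= t0 -> `|g1 y - g1 x| <= K * `|g2 y - g2 x|.
  move=> tx xy yt.
  have bound e : `|e| = 1 -> e * (g1 y - g1 x) <= K * (u y - u x).
    move=> e1.
    have [|c /andP[xc cy] E] :=
      @mean_value R (fun t => K * u t - e * g1 t) (fun t => K * (s * d2 t) - e * d1 t) x y xy.
      move=> z /andP[xz zy]; have [|d _ _ _] := comp z; first by lra.
      have d' : is_derive z (1:R) u (s * d2 z) by apply: du; lra.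
      have -> : (fun t : R => K * u t - e * g1 t) = K \*: u - e \*: g1 by [].
      exact: is_deriveB.
    have : 0 <= K * (s * d2 c) - e * d1 c.
      have [|b1 b2] := Ht0 c; first by rewrite ler_norml; lra.
      have : e * d1 c <= `|d1 0| + 1.
        by apply: (le_trans (ler_norm _)); rewrite normrM e1 mul1r.
      have : K * (s * d2 0 / 2) <= K * (s * d2 c) by rewrite ler_wpM2l.
      rewrite {1}/K divfK; last by rewrite gt_eqF//; lra.
      lra.
    move=> /mulr_ge0 /(_ (_ : 0 <= y - x)); rewrite subr_ge0 => /(_ xy).
    by rewrite -E; lra.
  have un : `|g2 y - g2 x| = u y - u x.
    have : u x <= u y by apply: umono; lra.
    by rewrite !g2u -mulrBr normrM => ?; case: s1 => ->; rewrite ?normrN1 ?normr1 mul1r ger0_norm// subr_ge0.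
  rewrite un ler_norml; have := bound 1; rewrite normr1 => /(_ erefl).
  by have := bound (- 1); rewrite normrN1 => /(_ erefl); lra.
move=> t t' ta pt ta' pt'.
have /andP[i1 i2] := inside _ ta pt; have /andP[j1 j2] := inside _ ta' pt'.
have [tt|tt] := leP t t'.
- by rewrite distrC [X in _ <= _ * X]distrC; apply: lip.
- by apply: lip => //; exact: ltW.
Unshelve. all: by end_near. Qed.

(** The first property lifts sequences of heights to [sigma]; the second lets areas be estimated
    from heights alone. *)
Lemma transverse_lipschitz_graph {R : realType} (F : R -> R)
    (sigma : set (R * R)) : transverse_section F sigma ->
  exists2 rho : R, 0 < rho & exists2 K : R, 0 <= K &
    (forall y, 0 < y < rho -> exists2 p, sigma p & p.2 = y) /\
    (forall p q, upper_part sigma rho p -> upper_part sigma rho q ->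
      `|p.1 - q.1| <= K * `|p.2 - q.2|).
Proof.
move=> [a [gamma [[a0 sg g0 dg0 ->] _]]].
have [|||rho rho0 [K K0 [hit lip]]] := @monotone_height_lipschitz R a
  (fun t => (gamma t).1) (fun t => (gamma t).2)
  (fun t => (derive1 gamma t).1) (fun t => (derive1 gamma t).2) a0.
- by rewrite g0.
- exact: smooth_curve_components.
- exact: dg0.
exists rho => //; exists K => //; split.
  by move=> y /hit[t ta <-]; exists (gamma t) => //; exists t => //=; rewrite in_itv.
move=> p q [[t /=]]; rewrite in_itv/= => ta <- pt [[t' /=]].
by rewrite in_itv/= => ta' <- pt'; exact: lip.
Qed.

(** * The slow divergence integral near the contact point *)

Lemma antiderivative {R : realType} (f : R -> R) (a : R) : 0 < a ->
  (forall x, - a <= x <= a -> {for x, continuous f}) ->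
  exists2 P : R -> R, P 0 = 0 &
    forall x : R, - a < x < a -> is_derive x (1:R) P (f x).
Proof.
move=> a0 cf.
have fi : (@lebesgue_measure R).-integrable `[- a, a] (EFin \o f).
  apply: continuous_compact_integrable; first exact: segment_compact.
  by apply/continuous_in_subspaceT => x; rewrite inE/= in_itv/=; exact: cf.
pose P0 x := (\int[@lebesgue_measure R]_(t in `[- a, x]) f t)%R.
exists (fun x => P0 x - P0 0); first by rewrite subrr.
move=> x /andP[ax xa].
have [|dP P'] := continuous_FTC1_closed xa fi ax _; first by apply: cf; rewrite !ltW.
have dP0 : is_derive x (1:R) P0 (f x).
  by apply: DeriveDef; [exact: dP|rewrite -P' derive1E].
have -> : (fun x => P0 x - P0 0) = P0 - cst (P0 0) by [].
by rewrite -[f x]subr0; apply: is_deriveB.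
Qed.

Lemma Rintegral_derive {R : realType} (f P : R -> R) (a b : R) : a < b ->
  (forall x, a <= x <= b -> {for x, continuous f}) ->
  (forall x : R, a <= x <= b -> is_derive x (1:R) P (f x)) ->
  \int[@lebesgue_measure R]_(x in `[a, b]) f x = P b - P a.
Proof.
move=> ab cf dP.
have cP x : a <= x <= b -> {for x, continuous P}.
  by move=> /dP[d _]; exact/differentiable_continuous/derivable1_diffP.
rewrite /Rintegral (@continuous_FTC2 _ _ P)//.
- apply/continuous_in_subspaceT => x; rewrite inE/= in_itv/=; exact: cf.
- split.
  + by move=> x /[!in_itv]/= /andP[ax xb]; have [|] := dP x => //; rewrite !ltW.
  + by apply: cvg_at_right_filter; apply: cP; rewrite lexx ltW.
  + by apply: cvg_at_left_filter; apply: cP; rewrite lexx ltW.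
- move=> x /[!in_itv]/= /andP[ax xb]; rewrite derive1E.
  by have [|] := dP x => //; rewrite !ltW.
Qed.

(* G is F'(x) / x extended to x = 0, and P a primitive of the integrand
   F'(x)^2 / x of the slow divergence integral. *)
Definition contact_germ {R : realType} (r M : R) (F G dG P : R -> R) : Prop :=
  [/\ 0 < r, F 0 = 0, P 0 = 0 & forall x : R, `|x| < r ->
    [/\ is_derive x (1:R) F (x * G x), is_derive x (1:R) G (dG x),
        is_derive x (1:R) P (x * G x ^+ 2), 3 / 2 <= G x <= 5 / 2 &
        `|dG x| <= M]].

Lemma near_norm_lt {R : realType} (a x : R) : `|x| < a ->
  \forall y \near x, `|y| < a.
Proof. exact: (cvgr_lt _ (@norm_continuous _ _ x)). Qed.

(** Differentiating [x^2 - x^3 H_0] gives x times [G = 2 - 3 x H_0 - x^2 H_1], so [G 0 = 2] and the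
    singular quotient [F'^2 / x] becomes the continuous function [x G^2]. Continuity of [G] and of
    its derivative at 0 provides [r] and [M]. *)
Lemma contact_germ_exists {R : realType} (a : R) (F : R -> R)
    (H : nat -> R -> R) : 0 < a ->
  (forall x, `|x| < a -> F x = x ^+ 2 - x ^+ 3 * H 0%N x) ->
  (forall k (x : R), `|x| < a -> is_derive x (1:R) (H k) (H k.+1 x)) ->
  exists r M G dG P, r <= a /\ contact_germ r M F G dG P.
Proof.
move=> a0 FE dH.
pose G x := 2 - 3 * x * H 0%N x - x ^+ 2 * H 1%N x.
pose dG x := - 3 * H 0%N x - 5 * x * H 1%N x - x ^+ 2 * H 2%N x.
have cH k x : `|x| < a -> {for x, continuous (H k)}.
  by move=> /(dH k)[d _]; exact/differentiable_continuous/derivable1_diffP.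
have dX (x : R) : is_derive x (1:R) (@idfun R) 1 by exact: is_derive_id.
have dF (x : R) : `|x| < a -> is_derive x (1:R) F (x * G x).
  move=> xa.
  have h0 := dH 0%N x xa.
  have d1 : is_derive x (1:R) (fun x => x ^+ 2 - x ^+ 3 * H 0%N x) (x * G x).
    by apply: is_derive_eq; rewrite /G /GRing.scale/=; ring.
  apply: (near_eq_is_derive _ d1).
  by apply: filterS (near_norm_lt xa) => y /FE ->.
have dG' (x : R) : `|x| < a -> is_derive x (1:R) G (dG x).
  move=> xa; have h0 := dH 0%N x xa; have h1 := dH 1%N x xa.
  have dc2 : is_derive x (1:R) (cst (2:R)) 0 by exact: is_derive_cst.
  have dc3 : is_derive x (1:R) (cst (3:R)) 0 by exact: is_derive_cst.
  have -> : G = cst 2 - cst 3 * idfun * H 0%N - idfun ^+ 2 * H 1%N.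
    by apply/funext => t.
  apply: is_derive_eq; rewrite /dG /GRing.scale/=.
  rewrite -[(cst 3 * idfun) x]/(3 * x) -[(idfun ^+ 2) x]/(x * x); ring.
have cG (x : R) : `|x| < a -> {for x, continuous G}.
  by move=> /dG'[d _]; exact/differentiable_continuous/derivable1_diffP.
have a00 : `|0 : R| < a by rewrite normr0.
have cdG : {for 0, continuous dG}.
  apply: cvgB; first apply: cvgB.
  - by apply: cvgMr; exact: cH.
  - by apply: cvgM; [apply: cvgMr; exact: cvg_id|exact: cH].
  - by apply: cvgM; [exact: exprn_continuous|exact: cH].
have G0 : G 0 = 2 by rewrite /G; ring.
have [r [r0 ra Hr]] : exists r : R, [/\ 0 < r, r < a & forall t, `|t| <= r ->
    3 / 2 <= G t <= 5 / 2 /\ `|dG t| <= `|dG 0| + 1].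
  have : \forall t \near (0:R), `|G 0 - G t| < 1 / 2 /\ `|dG 0 - dG t| < 1.
    near=> t; split; near: t.
    - by move/cvgrPdist_lt : (cG _ a00); apply; lra.
    - by move/cvgrPdist_lt : cdG; apply; rewrite ltr01.
  move=> /nbhs_ballP[e /= e0 He].
  exists (Num.min (e / 2) (a / 2)); split.
  - by rewrite lt_min; apply/andP; split; lra.
  - by rewrite gt_min; apply/orP; right; lra.
  move=> t; rewrite le_min => /andP[te ta].
  have [|h1 h2] := He t; first by rewrite /ball/= sub0r normrN; lra.
  split; first by move: h1; rewrite G0 ltr_norml => /andP[]; lra.
  by have := ler_normB (dG 0) (dG 0 - dG t); rewrite opprB addrC subrK; lra.
have [||P P0 dP] := @antiderivative R (fun x => x * G x ^+ 2) r => //.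
  move=> x /andP[x1 x2]; have xa : `|x| < a by rewrite ltr_norml; lra.
  by apply: cvgM; [exact: cvg_id|exact: (cvgM (cG _ xa) (cG _ xa))].
exists r, (`|dG 0| + 1), G, dG, P; split; first exact: ltW.
have F0 : F 0 = 0 by rewrite (FE _ a00) !expr0n mul0r subrr.
split; [exact: r0|exact: F0|exact: P0|].
move=> x xr; have xa : `|x| < a by exact: lt_trans ra.
have [G1 dG1] := Hr _ (ltW xr).
have xr' : - r < x < r by rewrite -ltr_norml.
by split; [exact: dF|exact: dG'|exact: dP|exact: G1|exact: dG1].
Unshelve. all: by end_near. Qed.

Lemma is_derive_comp_opp {R : realType} (f : R -> R) (x a : R) :
  is_derive (- x) (1:R) f a -> is_derive x (1:R) (fun t => f (- t)) (- a).
Proof.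
move=> df; have d1 : is_derive x (1:R) (-%R : R -> R) (- 1) by exact: is_deriveNid.
have := is_derive1_comp df d1; by rewrite mulrN1.
Qed.

(** The factor [t] gives the derivative the sign of [t], so [f] grows away from 0 on either side.
    The condition [0 <= x * y] puts both points on the same side, which treats the two branches of
    the critical curve at once. *)
Lemma le_of_derive_factor {R : realType} (f k : R -> R) (r x y : R) :
  (forall t : R, `|t| < r -> is_derive t (1:R) f (t * k t)) ->
  (forall t, `|t| < r -> 0 <= k t) ->
  0 <= x * y -> `|x| <= `|y| -> `|y| < r -> f x <= f y.
Proof.
move=> df k0 xy0 xy yr.
have inr c : (x <= c <= y) || (y <= c <= x) -> `|c| < r.
  have := le_lt_trans xy yr; move: yr; rewrite !ltr_norml.
  by move=> /andP[? ?] /andP[? ?] /orP[]/andP[? ?]; apply/andP; split; lra.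
have [y0|y0|y0] := ltgtP y 0; last first.
- by move: xy; rewrite y0 normr0 normr_le0 => /eqP ->.
- have x0 : 0 <= x by rewrite -(pmulr_lge0 _ y0).
  have {}xy : x <= y by move: xy; rewrite !ger0_norm// ltW.
  have [|c /andP[c1 c2] E] := @mean_value R f (fun t => t * k t) x y xy.
    by move=> c cxy; apply: df; apply: inr; rewrite cxy.
  rewrite -subr_ge0 E; apply: mulr_ge0; last by rewrite subr_ge0.
  by apply: mulr_ge0; [exact: le_trans c1|apply: k0; apply: inr; rewrite c1 c2].
- have x0 : x <= 0 by rewrite -(nmulr_lge0 _ y0).
  have {}xy : y <= x by move: xy; rewrite !ler0_norm ?lerN2// ltW.
  have [|c /andP[c1 c2] E] := @mean_value R f (fun t => t * k t) y x xy.
    by move=> c cxy; apply: df; apply: inr; rewrite cxy orbT.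
  rewrite -subr_le0 E; apply: mulr_le0_ge0; last by rewrite subr_ge0.
  by apply: mulr_le0_ge0; [exact: le_trans x0|apply: k0; apply: inr; rewrite c1 c2 orbT].
Qed.

Section ContactGerm.
Context {R : realType} (r M : R) (F G dG P : R -> R).
Hypothesis germ : contact_germ r M F G dG P.

(** [P - 3/2 F] and [5/2 F - P] have derivatives [x G (G - 3/2)] and [x G (5/2 - G)], with
    nonnegative cofactors of x. *)
Lemma germ_compare_primitive x y : 0 <= x * y -> `|x| <= `|y| -> `|y| < r ->
  3 / 2 * (F y - F x) <= P y - P x <= 5 / 2 * (F y - F x).
Proof.
case: germ => r0 _ _ g xy0 xy yr.
have L : (P - (3 / 2) \*: F) x <= (P - (3 / 2) \*: F) y.
  apply: (@le_of_derive_factor R _ (fun t => G t * (G t - 3 / 2)) r x y _ _ xy0 xy yr).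
  - move=> t /g[dF _ dP _ _]; apply: is_derive_eq.
    by rewrite /GRing.scale/=; ring.
  - by move=> t /g[_ _ _ /andP[G1 G2] _]; apply: mulr_ge0; lra.
move: L; rewrite /= => L.
have U : ((5 / 2) \*: F - P) x <= ((5 / 2) \*: F - P) y.
  apply: (@le_of_derive_factor R _ (fun t => G t * (5 / 2 - G t)) r x y _ _ xy0 xy yr).
  - move=> t /g[dF _ dP _ _]; apply: is_derive_eq.
    by rewrite /GRing.scale/=; ring.
  - by move=> t /g[_ _ _ /andP[G1 G2] _]; apply: mulr_ge0; lra.
move: L U; rewrite -[(P - _) x]/(P x - 3 / 2 * F x) -[(P - _) y]/(P y - 3 / 2 * F y).
rewrite -[(_ - P) x]/(5 / 2 * F x - P x) -[(_ - P) y]/(5 / 2 * F y - P y).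
by move=> *; lra.
Qed.

Lemma germ_quadratic x y : 0 <= x * y -> `|x| <= `|y| -> `|y| < r ->
  3 / 4 * (y ^+ 2 - x ^+ 2) <= F y - F x <= 5 / 4 * (y ^+ 2 - x ^+ 2).
Proof.
case: germ => r0 _ _ g xy0 xy yr.
pose q : R -> R := idfun * idfun.
have dq (t : R) : is_derive t (1:R) q (t + t).
  have di : is_derive t (1:R) (@idfun R) 1 by exact: is_derive_id.
  by apply: is_derive_eq; rewrite /GRing.scale/=; ring.
have L : (F - (3 / 4) \*: q) x <= (F - (3 / 4) \*: q) y.
  apply: (@le_of_derive_factor R _ (fun t => G t - 3 / 2) r x y _ _ xy0 xy yr).
  - move=> t /g[dF _ dP _ _]; have dqt := dq t; apply: is_derive_eq.
    by rewrite /GRing.scale/=; field.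
  - by move=> t /g[_ _ _ /andP[G1 G2] _]; lra.
move: L; rewrite /= => L.
have U : ((5 / 4) \*: q - F) x <= ((5 / 4) \*: q - F) y.
  apply: (@le_of_derive_factor R _ (fun t => 5 / 2 - G t) r x y _ _ xy0 xy yr).
  - move=> t /g[dF _ dP _ _]; have dqt := dq t; apply: is_derive_eq.
    by rewrite /GRing.scale/=; field.
  - by move=> t /g[_ _ _ /andP[G1 G2] _]; lra.
move: L U; rewrite -[(F - _) x]/(F x - 3 / 4 * x ^+ 2) -[(F - _) y]/(F y - 3 / 4 * y ^+ 2).
rewrite -[(_ - F) x]/(5 / 4 * x ^+ 2 - F x) -[(_ - F) y]/(5 / 4 * y ^+ 2 - F y).
by move=> *; lra.
Qed.

(* Both summands of the derivative of [P x - P (- x)] combine into the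
   derivative of [F x - F (- x)] times [G x + G (- x)], so that integrating by
   parts leaves only the small term [F x - F (- x)]. *)
Lemma germ_parts z B : 0 <= z < r ->
  (forall x, 0 <= x <= z -> `|F x - F (- x)| <= B) ->
  `|P z - P (- z) - (F z - F (- z)) * (G z + G (- z))| <= 2 * M * B * z.
Proof.
case: germ => r0 F0 P0 g /andP[z0 zr] DB.
pose W x := P x - P (- x) - (F x - F (- x)) * (G x + G (- x)).
pose dW x := - (F x - F (- x)) * (dG x - dG (- x)).
have dWP x : 0 <= x <= z -> is_derive x (1:R) W (dW x).
  move=> /andP[x0 xz].
  have xr : `|x| < r by rewrite ger0_norm//; exact: le_lt_trans zr.
  have xr' : `|- x| < r by rewrite normrN.
  have [dF1 dG1 dP1 _ _] := g _ xr.
  have [/is_derive_comp_opp dF2 /is_derive_comp_opp dG2 /is_derive_comp_opp dP2 _ _] := g _ xr'.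
  pose F' t := F (- t); pose G' t := G (- t); pose P' t := P (- t).
  have -> : W = P - P' - (F - F') * (G + G') by [].
  have dF3 : is_derive x (1:R) F' (- (- x * G (- x))) by [].
  have dG3 : is_derive x (1:R) G' (- dG (- x)) by [].
  have dP3 : is_derive x (1:R) P' (- (- x * G (- x) ^+ 2)) by [].
  apply: is_derive_eq; rewrite /dW /GRing.scale/=.
  rewrite -[(F - F') x]/(F x - F (- x)) -[(G + G') x]/(G x + G (- x)).
  by ring.
have [c c1 E] := mean_value z0 dWP.
have W0 : W 0 = 0 by rewrite /W oppr0 !subrr mul0r subrr.
move: E; rewrite W0 !subr0 -/(W z) => ->.
rewrite normrM (ger0_norm z0) ler_wpM2r// /dW normrM normrN.
have /andP[c0 cz] := c1.
have cr : `|c| < r by rewrite ger0_norm//; exact: le_lt_trans zr.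
have [_ _ _ _ m1] := g _ cr.
have [|_ _ _ _ m2] := g (- c); first by rewrite normrN.
have : `|dG c - dG (- c)| <= 2 * M.
  by have := ler_normB (dG c) (dG (- c)); lra.
move=> dM; rewrite [X in _ <= X]mulrC.
by apply: ler_pM dM; [exact: normr_ge0|exact: normr_ge0|exact: DB].
Qed.

(** With [D = F z - F (- z)], the hypothesis gives [F w - F z = - D]. Hence [P w - P z] is [-2 D] up
    to |D|/2, because [G] is within 1/2 of 2, and [P z - P (- z)] is [4 D] up to |D|, because
    [G z + G (- z)] is within 1 of 4, and up to the remainder [2 M B z] of the integration by
    parts. *)
Lemma germ_divergence z w B : 0 <= z < r -> 0 <= w < r -> F w = F (- z) ->
  (forall x, 0 <= x <= z -> `|F x - F (- x)| <= B) ->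
  `|P w - P (- z) - 2 * (F z - F (- z))| <=
    3 / 2 * `|F z - F (- z)| + 2 * M * B * z.
Proof.
move=> zr wr Fwz DB.
have parts := germ_parts zr DB.
case: germ => r0 F0 P0 g.
case/andP: zr => z0 zr; case/andP: wr => w0 wr.
have zr' : `|z| < r by rewrite ger0_norm.
have [_ _ _ /andP[G1 G2] _] := g _ zr'.
have [|_ _ _ /andP[G3 G4] _] := g (- z); first by rewrite normrN.
have step : `|(P w - P z) - 2 * (F w - F z)| <= 1 / 2 * `|F w - F z|.
  have [zw|wz] := leP z w.
  - have /andP[p1 p2] : 3 / 2 * (F w - F z) <= P w - P z <= 5 / 2 * (F w - F z).
      by apply: germ_compare_primitive; rewrite ?mulr_ge0// !ger0_norm.
    by rewrite [`|F w - _|]ger0_norm ?ler_norml; lra.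
  - have /andP[p1 p2] : 3 / 2 * (F z - F w) <= P z - P w <= 5 / 2 * (F z - F w).
      by apply: germ_compare_primitive; rewrite ?mulr_ge0// !ger0_norm// ltW.
    by rewrite distrC [`|F w - _|]distrC [`|F z - _|]ger0_norm ?ler_norml; lra.
set D := F z - F (- z) in parts *.
have DE : F w - F z = - D by rewrite Fwz /D opprB.
move: step; rewrite DE normrN => step.
have S1 : `|D * (G z + G (- z) - 4)| <= 1 * `|D|.
  by rewrite normrM mulrC ler_wpM2r// ler_norml; lra.
have -> : P w - P (- z) - 2 * D = (P z - P (- z) - D * (G z + G (- z))) +
   D * (G z + G (- z) - 4) + (P w - P z - 2 * - D) by ring.
apply: le_trans (ler_normD _ _) _; apply: le_trans (lerD (ler_normD _ _) (lexx _)) _.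
by lra.
Qed.

End ContactGerm.

(* The two halves of the slow divergence integral, from alpha_pt y to 0 and from
   0 to omega_pt y, depend on the height y in this way because
   dP = (F'(x) / x) dF and F'(x) / x is close to 2. *)
Definition bilipschitz_profile {R : realType} (rho : R) (J : R -> R) : Prop :=
  J 0 = 0 /\ forall y y', 0 <= y -> y <= y' -> y' < rho ->
    3 / 2 * (y' - y) <= J y' - J y <= 5 / 2 * (y' - y).

Section Branches.
Context {R : realType} (r M : R) (F G dG P : R -> R).
Hypothesis germ : contact_germ r M F G dG P.

Lemma germ_strict x y : 0 <= x * y -> `|x| < `|y| -> `|y| < r -> F x < F y.
Proof.
move=> xy0 xy yr.
have /andP[] := germ_quadratic germ xy0 (ltW xy) yr.
have : x ^+ 2 < y ^+ 2.
  by rewrite -real_normK ?num_real// -[y ^+ 2]real_normK ?num_real// ltr_pXn2r ?nnegrE.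
by move=> *; lra.
Qed.

Lemma germ_continuous x : `|x| < r -> {for x, continuous F}.
Proof.
case: germ => _ _ _ g /g[[d _] _ _ _ _].
exact/differentiable_continuous/derivable1_diffP.
Qed.

(** The bound [3/16 r^2] is [3/4 (r/2)^2], below which [F (r/2)] cannot fall, so a solution exists
    in []0, r/2]]. Strict monotonicity excludes smaller positive ones, and the infimum ignores
    whatever [F] does farther away. *)
Lemma omega_ptP y : 0 < y < 3 / 16 * r ^+ 2 ->
  0 < omega_pt F y < r /\ F (omega_pt F y) = y.
Proof.
move=> /andP[y0 yr]; have [r0 F0 _ _] := germ.
have r20 : 0 <= r / 2 by lra.
have r2r : `|r / 2| < r by rewrite ger0_norm//; lra.
have Fr : 3 / 16 * r ^+ 2 <= F (r / 2).
  have /andP[] : 3 / 4 * ((r / 2) ^+ 2 - 0 ^+ 2) <= F (r / 2) - F 0 <= 5 / 4 * ((r / 2) ^+ 2 - 0 ^+ 2).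
    by apply: (germ_quadratic germ); [rewrite mul0r|rewrite normr0|].
  by rewrite F0 => h _; move: h; lra.
have [||c /andP[c0 cr] Fc] := @intermediate_value R F 0 (r / 2) y r20.
- move=> x /andP[x0 xr]; apply: germ_continuous; rewrite ger0_norm//; lra.
- by apply/orP; left; rewrite F0 (ltW y0)/=; lra.
have {}c0 : 0 < c.
  rewrite lt_neqAle c0 andbT; apply/eqP => c0'.
  by move: Fc y0; rewrite -c0' F0 => ->; rewrite ltxx.
suff -> : omega_pt F y = c by split=> //; lra.
apply/eqP; rewrite eq_le; apply/andP; split.
- apply: ge_inf => //; by exists 0 => x [/ltW].
- apply: lb_le_inf; first by exists c.
  move=> x [x0 Fx]; rewrite leNgt; apply/negP => xc.
  have : F x < F c.
    by apply: germ_strict; [rewrite mulr_ge0// ltW|rewrite !gtr0_norm|rewrite gtr0_norm//; lra].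
  by rewrite Fx Fc ltxx.
Qed.

Lemma alpha_ptP y : 0 < y < 3 / 16 * r ^+ 2 ->
  - r < alpha_pt F y < 0 /\ F (alpha_pt F y) = y.
Proof.
move=> /andP[y0 yr]; have [r0 F0 _ _] := germ.
have r20 : - (r / 2) <= 0 by lra.
have r2r : `|- (r / 2)| < r by rewrite ler0_norm//; lra.
have Fr : 3 / 16 * r ^+ 2 <= F (- (r / 2)).
  have /andP[] : 3 / 4 * ((- (r / 2)) ^+ 2 - 0 ^+ 2) <= F (- (r / 2)) - F 0 <= 5 / 4 * ((- (r / 2)) ^+ 2 - 0 ^+ 2).
    by apply: (germ_quadratic germ); [rewrite mul0r|rewrite normr0|].
  by rewrite F0 => h _; move: h; lra.
have [||c /andP[cr c0] Fc] := @intermediate_value R F (- (r / 2)) 0 y r20.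
- move=> x /andP[xr x0]; apply: germ_continuous; rewrite ler0_norm//; lra.
- by apply/orP; right; rewrite F0 (ltW y0)/=; lra.
have {}c0 : c < 0.
  rewrite lt_neqAle c0 andbT; apply/eqP => c0'.
  by move: Fc y0; rewrite c0' F0 => ->; rewrite ltxx.
suff -> : alpha_pt F y = c by split=> //; lra.
apply/eqP; rewrite eq_le; apply/andP; split.
- apply: ge_sup; first by exists c.
  move=> x [x0 Fx]; rewrite leNgt; apply/negP => xc.
  have : F x < F c.
    by apply: germ_strict; [rewrite mulr_le0// ltW|rewrite !ltr0_norm// ltrN2|rewrite ltr0_norm//; lra].
  by rewrite Fx Fc ltxx.
- apply: ub_le_sup => //; by exists 0 => x [/ltW].
Qed.

Lemma slow_divergence_primitive p q :
  0 < p.2 < 3 / 16 * r ^+ 2 -> 0 < q.2 < 3 / 16 * r ^+ 2 ->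
  slow_divergence F p q = P (omega_pt F q.2) - P (alpha_pt F p.2).
Proof.
move=> /alpha_ptP[]; set al := alpha_pt F p.2 => /andP[al1 al0] _.
move=> /omega_ptP[]; set om := omega_pt F q.2 => /andP[om0 om1] _.
have [_ _ _ g] := germ.
have inr x : al <= x <= om -> `|x| < r.
  by move=> /andP[? ?]; rewrite ltr_norml; apply/andP; split; lra.
have <- : \int[@lebesgue_measure R]_(x in `[al, om]) (x * G x ^+ 2) = P om - P al.
  apply: Rintegral_derive.
  - exact: lt_trans om0.
  - move=> x /inr /g[_ [d _] _ _ _].
    have cG : {for x, continuous G}.
      exact/differentiable_continuous/derivable1_diffP.
    by apply: cvgM; [exact: cvg_id|exact: (cvgM cG cG)].
  - by move=> x /inr /g[].
apply: eq_Rintegral => x; rewrite inE/= in_itv/= => /inr /g[dF _ _ _ _].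
rewrite derive1E (@derive_val _ _ _ _ _ _ _ dF).
(* At 0 the convention on division yields 0, which is also the value of [x G^2]. *)
have [->|x0] := eqVneq x 0; first by rewrite !mul0r expr0n mul0r.
by field.
Qed.

(* s = 1 is the attracting branch, s = -1 the repelling one. *)
Lemma profile_of_branch (s : R) (w : R -> R) (rho : R) : `|s| = 1 -> w 0 = 0 ->
  (forall y, 0 <= y < rho -> 0 <= s * w y < r /\ F (w y) = y) ->
  bilipschitz_profile rho (P \o w).
Proof.
have [_ F0 P0 _] := germ.
move=> s1 w0 Hw; split; first by rewrite /= w0 P0.
have nw y : 0 <= y < rho -> `|w y| = s * w y.
  by move=> /Hw[/andP[? _] _]; rewrite -[LHS]mul1r -s1 -normrM ger0_norm.
move=> y y' y0 yy' yr.
have Iy : 0 <= y < rho by rewrite y0 (le_lt_trans yy').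
have Iy' : 0 <= y' < rho by rewrite yr (le_trans y0).
have [/andP[a1 a2] Fy] := Hw _ Iy; have [/andP[b1 b2] Fy'] := Hw _ Iy'.
have same : 0 <= w y * w y'.
  have : 0 <= (s * w y) * (s * w y') by rewrite mulr_ge0.
  by rewrite mulrACA -expr2 -real_normK ?num_real// s1 expr1n mul1r.
have ww : `|w y| <= `|w y'|.
  rewrite leNgt; apply/negP => lt; have : F (w y') < F (w y).
    by apply: germ_strict => //; [rewrite mulrC|rewrite nw].
  by rewrite Fy Fy' ltNge yy'.
have wr : `|w y'| < r by rewrite nw.
by have := germ_compare_primitive germ same ww wr; rewrite Fy Fy'.
Qed.

(** [J] and [L] are [P] along the attracting and the repelling branch, and [Z] is minus the abscissa
    on the repelling one. By [germ_divergence], [J - L] is governed by the odd part of [F] at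
    [Z]. *)
Lemma divergence_profile : exists rho : R, exists J L Z : R -> R,
  [/\ 0 < rho, bilipschitz_profile rho J, bilipschitz_profile rho L,
    forall p q, 0 < p.2 < rho -> 0 < q.2 < rho ->
      slow_divergence F p q = J q.2 - L p.2 &
    forall y, 0 < y < rho ->
      [/\ 0 < Z y < r, 3 / 4 * Z y ^+ 2 <= y <= 5 / 4 * Z y ^+ 2 & forall B,
       (forall x, 0 <= x <= Z y -> `|F x - F (- x)| <= B) ->
       `|J y - L y - 2 * (F (Z y) - F (- Z y))| <=
         3 / 2 * `|F (Z y) - F (- Z y)| + 2 * M * B * Z y]].
Proof.
have [r0 F0 P0 _] := germ.
pose rho := 3 / 16 * r ^+ 2.
(* The value at height 0 is set by hand: [omega_pt F 0] and [alpha_pt F 0] see only the nonzero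
   zeros of [F]. *)
pose om y : R := if 0 < y then omega_pt F y else 0.
pose al y : R := if 0 < y then alpha_pt F y else 0.
have omP y : 0 <= y < rho -> 0 <= 1 * om y < r /\ F (om y) = y.
  move=> /andP[y0 yr]; rewrite mul1r /om; case: ifPn => y0'.
    have [|/andP[/ltW -> ->] ->] := @omega_ptP y; first by rewrite y0' yr.
    by split.
  have -> : y = 0 by apply/eqP; rewrite eq_le y0 leNgt y0'.
  by rewrite lexx r0.
have alP y : 0 <= y < rho -> 0 <= - 1 * al y < r /\ F (al y) = y.
  move=> /andP[y0 yr]; rewrite mulN1r /al; case: ifPn => y0'.
    have [|/andP[a1 a2] ->] := @alpha_ptP y; first by rewrite y0' yr.
    by split=> //; rewrite oppr_ge0 (ltW a2)/= ltrNl.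
  have -> : y = 0 by apply/eqP; rewrite eq_le y0 leNgt y0'.
  by rewrite oppr0 lexx r0.
exists rho, (P \o om), (P \o al), (fun y => - al y); split.
- by rewrite mulr_gt0// ?exprn_gt0//; lra.
- by apply: (@profile_of_branch 1); rewrite ?normr1// /om ltxx.
- by apply: (@profile_of_branch (- 1)); rewrite ?normrN1// /al ltxx.
- move=> p q pr qr; rewrite slow_divergence_primitive//= /om /al.
  by case/andP: pr => -> _; case/andP: qr => -> _.
move=> y /andP[y0 yr].
have Iy : 0 <= y < rho by rewrite (ltW y0).
have [om1 Fom] := omP _ Iy; have [al1 Fal] := alP _ Iy.
rewrite mul1r in om1; rewrite mulN1r in al1.
have al0 : 0 < - al y.
  rewrite oppr_gt0 /al y0; have [|/andP[]] := @alpha_ptP y => //.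
  by rewrite y0.
split.
- by rewrite al0; case/andP: al1.
- have : 3 / 4 * (al y ^+ 2 - 0 ^+ 2) <= F (al y) - F 0 <= 5 / 4 * (al y ^+ 2 - 0 ^+ 2).
    apply: (germ_quadratic germ); rewrite ?mul0r ?normr0 ?normr_ge0//.
    by rewrite -normrN gtr0_norm//; case/andP: al1.
  by rewrite F0 Fal expr0n !subr0 sqrrN.
- move=> B DB; rewrite opprK /=.
  have := @germ_divergence R r M F G dG P germ (- al y) (om y) B al1 om1.
  by rewrite opprK Fom Fal; apply.
Qed.

End Branches.

(** * Taylor expansion of the even part *)

Definition near_order {R : realType} (f : R -> R) (n : nat) : Prop :=
  exists K : R, \forall x \near (0:R), `|f x| <= K * `|x| ^+ n.

Lemma near_orderD {R : realType} (f g : R -> R) n :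
  near_order f n -> near_order g n -> near_order (fun x => f x + g x) n.
Proof.
move=> [K fK] [L gL]; exists (K + L).
apply: filterS2 fK gL => x fx gx.
by apply: le_trans (ler_normD _ _) _; rewrite mulrDl lerD.
Qed.

Lemma near_order_le {R : realType} (f : R -> R) n m : (n <= m)%N ->
  near_order f m -> near_order f n.
Proof.
move=> nm [K fK]; exists `|K|.
have near1 : \forall x \near (0:R), `|x| < 1 by apply: near_norm_lt; rewrite normr0.
apply: filterS2 fK near1 => x fx x1; apply: le_trans fx _.
apply: le_trans (ler_wpM2r (exprn_ge0 _ (normr_ge0 _)) (ler_norm K)) _.
by apply: ler_wpM2l => //; apply: ler_wiXn2l nm => //; exact: ltW.
Qed.

Lemma near_order_opp {R : realType} (f : R -> R) n :
  near_order f n -> near_order (fun x => f (- x)) n.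
Proof.
move=> [K fK]; exists K; move: fK => /nbhs_ballP[e e0 fK].
apply/nbhs_ballP; exists e => // x xe.
have := fK (- x); rewrite normrN; apply.
by move: xe; rewrite /ball/= !sub0r opprK normrN.
Qed.

Lemma continuous_near_order {R : realType} (f : R -> R) :
  {for 0, continuous f} -> near_order f 0.
Proof.
move=> cf; exists (`|f 0| + 1); move/cvgrPdist_lt : cf => /(_ 1 ltr01).
apply: filterS => x fx; rewrite expr0 mulr1.
by have := ler_normB (f 0) (f 0 - f x); rewrite opprB addrC subrK; lra.
Qed.

Definition poly_primitive {R : realType} (p : {poly R}) : {poly R} :=
  \poly_(i < (size p).+1) (p`_i.-1 / i%:R).

Lemma deriv_poly_primitive {R : realType} (p : {poly R}) :
  (poly_primitive p)^`() = p.
Proof.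
apply/polyP => i; rewrite coef_deriv coef_poly ltnS /=.
case: ltnP => ip; last by rewrite nth_default// mul0rn.
by rewrite -[LHS]mulr_natr divfK// pnatr_eq0.
Qed.

(** Induction on the order: the shifted tower gives a polynomial close to [H 1], its primitive is
    adjusted to agree with [H 0] at 0, and the mean value theorem gains one power of x. *)
Lemma taylor_near_order {R : realType} (n : nat) (a : R) (H : nat -> R -> R) :
  0 < a ->
  (forall k (x : R), `|x| < a -> is_derive x (1:R) (H k) (H k.+1 x)) ->
  exists p : {poly R}, near_order (fun x => H 0%N x - p.[x]) n.
Proof.
move=> a0; elim: n H => [|n IH] H dH.
  exists 0; have -> : (fun x => H 0%N x - (0 : {poly R}).[x]) = H 0%N.
    by apply/funext => x; rewrite horner0 subr0.
  apply: continuous_near_order.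
  have [|d _] := dH 0%N 0; first by rewrite normr0.
  exact/differentiable_continuous/derivable1_diffP.
have [p [K Hp]] := IH (fun k => H k.+1) (fun k => dH k.+1).
pose q := poly_primitive p + (H 0%N 0 - (poly_primitive p).[0])%:P.
have q' : q^`() = p by rewrite derivD derivC addr0 deriv_poly_primitive.
have q0 : q.[0] = H 0%N 0 by rewrite hornerD hornerC addrC subrK.
pose g x := H 0%N x - q.[x].
have dg x : `|x| < a -> is_derive x (1:R) g (H 1%N x - p.[x]).
  move=> xa; have d1 := dH _ _ xa; rewrite -q'.
  have d2 := is_derive_poly q x.
  have -> : g = H 0%N - horner q by [].
  exact: is_deriveB.
exists q, K.
have neara : \forall x \near (0:R), `|x| < a by apply: near_norm_lt; rewrite normr0.
have : \forall x \near (0:R), `|x| < a /\ `|H 1%N x - p.[x]| <= K * `|x| ^+ n.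
  by apply: filterS2 neara Hp => x.
move=> /nbhs_ballP[e e0 He].
apply/nbhs_ballP; exists e => // x; rewrite /ball/= sub0r normrN => xe.
have inb c : `|c| <= `|x| -> `|c| < a /\ `|H 1%N c - p.[c]| <= K * `|c| ^+ n.
  by move=> cx; apply: He; rewrite /ball/= sub0r normrN (le_lt_trans cx).
have K0 : 0 <= K * `|x| ^+ n.
  by have [_] := inb x (lexx _); exact: le_trans.
have bound c : `|c| <= `|x| -> `|H 1%N c - p.[c]| <= K * `|x| ^+ n.
  move=> cx; have [_ /le_trans] := inb _ cx; apply.
  have [Kp|Kn] := leP 0 K.
    by apply: ler_wpM2l => //; apply: lerXn2r; rewrite ?nnegrE.
  have xn0 : `|x| ^+ n <= 0 by rewrite -(nmulr_rge0 _ Kn).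
  apply: le_trans K0.
  by rewrite nmulr_rle0// exprn_ge0.
have g0 : g 0 = 0 by rewrite /g q0 subrr.
rewrite -/(g x) exprSr mulrA.
have [x0|x0] := leP 0 x.
- have [|c /andP[c0 cx]] := @mean_value R g (fun x => H 1%N x - p.[x]) 0 x x0.
    move=> c /andP[c0 cx]; apply: dg.
    by have [|] := inb c => //; rewrite !ger0_norm.
  rewrite g0 !subr0 => ->; rewrite normrM ler_wpM2r//.
  by apply: bound; rewrite !ger0_norm.
- have [|c /andP[cx c0]] := @mean_value R g (fun x => H 1%N x - p.[x]) x 0 (ltW x0).
    move=> c /andP[cx c0]; apply: dg.
    by have [|] := inb c => //; rewrite !ler0_norm ?lerN2// ltW.
  rewrite g0 !sub0r => /eqP; rewrite eqr_oppLR -mulrN opprK => /eqP ->.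
  rewrite normrM ler_wpM2r//.
  by apply: bound; rewrite !ler0_norm ?lerN2// ltW.
Qed.

(** In [p(x) + p(-x)] the odd coefficients cancel, including that of degree 2j+1, and the lower even
    ones vanish by hypothesis. Truncation below degree 2j+2 therefore leaves one monomial, and what
    is dropped is [x^(2j+2)] times a polynomial. *)
Lemma even_poly_near_order {R : realType} (p : {poly R}) (j : nat) :
  (forall i, (i < j)%N -> p`_(2 * i) = 0) ->
  near_order (fun x => p.[x] + p.[- x] - 2 * p`_(2 * j) * x ^+ (2 * j))
    (2 * j + 2).
Proof.
move=> pj; pose q := \poly_(i < size p) (p`_i + (-1) ^+ i * p`_i).
have qE x : q.[x] = p.[x] + p.[- x].
  rewrite horner_poly !horner_coef -big_split; apply: eq_bigr => i _ /=.
  by rewrite mulrDl; congr (_ + _); rewrite -[- x]mulN1r exprMn mulrCA mulrA.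
have qc i : q`_i = p`_i + (-1) ^+ i * p`_i.
  rewrite coef_poly; case: ltnP => // ip.
  by rewrite nth_default// mulr0 addr0.
have qt : take_poly (2 * j + 2) q = (2 * p`_(2 * j)) *: 'X^(2 * j).
  apply/polyP => i; rewrite coef_take_poly coefZ coefXn qc.
  have [odi|evi] := boolP (odd i).
    rewrite -signr_odd odi expr1 mulN1r subrr if_same.
    case: eqP => [E|_]; last by rewrite mulr0.
    by move: odi; rewrite E mul2n odd_double.
  have -> : i = (2 * i./2)%N by rewrite mul2n even_halfK.
  rewrite -signr_odd mul2n odd_double expr0 mul1r -mul2n.
  have [ij|ij|ij] := ltngtP i./2 j.
  - by rewrite pj// addr0 if_same eqn_mul2l/= (ltn_eqF ij) mulr0.
  - rewrite eqn_mul2l/= (gtn_eqF ij) mulr0 ifF//.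
    by rewrite -mulnSr ltn_mul2l/= ltnS leqNgt ij.
  - by rewrite ij eqxx mulr1 ifT; [ring|rewrite -mulnSr ltn_mul2l/=].
have [K HK] : near_order (horner (drop_poly (2 * j + 2) q)) 0.
  apply: continuous_near_order.
  have [d _] := is_derive_poly (drop_poly (2 * j + 2) q) (0:R).
  exact/differentiable_continuous/derivable1_diffP.
exists K; apply: filterS HK => x; rewrite expr0 mulr1 => Kx.
rewrite -qE -{1}(poly_take_drop (2 * j + 2) q) qt hornerD hornerZ hornerXn.
by rewrite addrC addKr hornerM hornerXn normrM normrX ler_wpM2r// exprn_ge0.
Qed.

Section EvenPart.
Context {R : realType} {l : nat} (h1 : R -> R -> 'rV[R]_l -> R)
  (lam0 : 'rV[R]_l).

Let h (x : R) : R := h1 x 0 lam0.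

Lemma even_part_orderP j : even_part_order h1 lam0 j <->
  exists2 alpha : R, alpha != 0 &
    near_order (fun x => h x + h (- x) - alpha * x ^+ (2 * j)) (2 * j + 2).
Proof.
split=> -[alpha alpha0].
- move=> /eqO_exP[k k0 Hk]; exists alpha => //; exists k.
  by move: Hk; apply: filterS => x /=; rewrite normrX.
- move=> [K HK]; exists alpha => //; apply/eqO_exP.
  exists (`|K| + 1); first by rewrite ltr_pwDr.
  apply: filterS HK => x /= /le_trans; apply.
  rewrite normrX ler_wpM2r ?exprn_ge0//.
  by apply: le_trans (ler_norm K) _; rewrite lerDl.
Qed.

(** The first nonzero even Taylor coefficient would exhibit a finite codimension, so by strong
    induction all those of degree at most 2j vanish. *)
Lemma flat_even_part j : smooth_h1 h1 lam0 -> infinite_codim h1 lam0 ->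
  near_order (fun x => h x + h (- x)) (2 * j).
Proof.
move=> /smooth_slice[a a0 [H Hh dH]] ninf.
have [p pH] := taylor_near_order (2 * j + 2) a0 dH.
have hp : near_order (fun x => h x - p.[x]) (2 * j + 2).
  have [K HK] := pH; exists K; apply: filterS2 HK (near_norm_lt (x := 0) (a := a) _) => [x|].
    by move=> + xa; rewrite Hh.
  by rewrite normr0.
have hep : near_order (fun x => h x + h (- x) - (p.[x] + p.[- x])) (2 * j + 2).
  have -> : (fun x => h x + h (- x) - (p.[x] + p.[- x])) =
     (fun x => (h x - p.[x]) + (h (- x) - p.[- x])) by apply/funext => x; ring.
  exact: near_orderD hp (near_order_opp hp).
have key i : (i <= j)%N -> (forall i', (i' < i)%N -> p`_(2 * i') = 0) ->
    near_order (fun x => h x + h (- x) - 2 * p`_(2 * i) * x ^+ (2 * i)) (2 * i + 2).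
  move=> ij pi.
  have -> : (fun x => h x + h (- x) - 2 * p`_(2 * i) * x ^+ (2 * i)) =
    (fun x => (h x + h (- x) - (p.[x] + p.[- x])) +
      (p.[x] + p.[- x] - 2 * p`_(2 * i) * x ^+ (2 * i))) by apply/funext => x; ring.
  apply: near_orderD; last exact: even_poly_near_order.
  by apply: near_order_le hep; rewrite leq_add2r leq_mul2l.
have zero i : (i <= j)%N -> p`_(2 * i) = 0.
  elim/ltn_ind: i => i IH ij; apply/eqP; apply/negPn/negP => pi0; apply: ninf.
  exists i; apply/even_part_orderP; exists (2 * p`_(2 * i)).
    by rewrite mulf_neq0// pnatr_eq0.
  by apply: key => // i' i'i; apply: IH => //; exact: ltnW (leq_trans i'i ij).
have := key j (leqnn j) (fun i ij => zero i (ltnW ij)).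
rewrite zero// => kj; apply: (near_order_le (leq_addr 2 _)).
by congr near_order: kj; apply/funext => x; rewrite mulr0 mul0r subr0.
Qed.

End EvenPart.

(** * Slow orbits *)

Lemma profile_continuous {R : realType} (rho : R) (J : R -> R) (y : R) :
  bilipschitz_profile rho J -> 0 < y < rho -> {for y, continuous J}.
Proof.
move=> [_ lip] /andP[y0 yr]; apply/cvgrPdist_lt => e e0.
have near1 : \forall t \near y, 0 < t by exact: lt_nbhsr.
have near2 : \forall t \near y, t < rho by exact: lt_nbhsl.
have near3 : \forall t \near y, `|y - t| < e / 3.
  by apply: (@cvgr_dist_lt _ _ _ (nbhs y) _ id y); [exact: cvg_id|lra].
near=> t.
have t0 : 0 < t by near: t.
have tr : t < rho by near: t.
have ty : `|y - t| < e / 3 by near: t.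
have [yt|ty'] := leP y t.
- have /andP[l1 l2] := lip _ _ (ltW y0) yt tr.
  rewrite distrC ger0_norm; first by move: ty; rewrite distrC ger0_norm; lra.
  by lra.
- have /andP[l1 l2] := lip _ _ (ltW t0) (ltW ty') yr.
  rewrite ger0_norm; first by move: ty; rewrite ger0_norm; lra.
  by lra.
Unshelve. all: by end_near. Qed.

Lemma profile_gap_sign {R : realType} (rho : R) (J L : R -> R) :
  bilipschitz_profile rho J -> bilipschitz_profile rho L ->
  (forall y, 0 < y < rho -> J y - L y != 0) ->
  (forall y, 0 < y < rho -> J y < L y) \/ (forall y, 0 < y < rho -> L y < J y).
Proof.
move=> pJ pL ne.
have zero u v : 0 < u < rho -> 0 < v < rho -> J u < L u -> L v < J v -> False.
  move=> ur vr fu fv.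
  have cJL x : 0 < x < rho -> {for x, continuous (fun x => J x - L x)}.
    by move=> xr; apply: cvgB; exact: profile_continuous xr.
  have [uv|vu] := leP u v.
  - have [|||c /andP[uc cv] fc] := @intermediate_value R (fun x => J x - L x) u v 0.
    + exact: uv.
    + by move=> x /andP[ux xv]; apply: cJL; lra.
    + by apply/orP; left; lra.
    + have : J c - L c != 0 by apply: ne; lra.
      by rewrite fc eqxx.
  - have [|||c /andP[uc cv] fc] := @intermediate_value R (fun x => J x - L x) v u 0.
    + exact: ltW.
    + by move=> x /andP[ux xv]; apply: cJL; lra.
    + by apply/orP; right; lra.
    + have : J c - L c != 0 by apply: ne; lra.
      by rewrite fc eqxx.
have [[u ur fu]|nex] := pselect (exists2 u, 0 < u < rho & J u < L u); [left|right] => v vr.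
- rewrite ltNge; apply/negP => fv; apply: (zero u v) => //.
  by rewrite lt_neqAle fv andbT; move: (ne _ vr); rewrite subr_eq0 eq_sym.
- rewrite lt_neqAle; apply/andP; split.
    by move: (ne _ vr); rewrite subr_eq0 eq_sym.
  by rewrite leNgt; apply/negP => fv; apply: nex; exists v.
Qed.

(* One step of the slow orbit solves B y' = A y, where (A, B) is (J, L) when
   I = J - L < 0 and (L, J) when I > 0. *)
Section Step.
Context {R : realType} (rho : R) (A B : R -> R).
Hypotheses (pA : bilipschitz_profile rho A) (pB : bilipschitz_profile rho B)
  (AB : forall y, 0 < y < rho -> A y < B y).

Lemma step_exists y : 0 < y < rho -> exists2 y', 0 < y' < y & B y' = A y.
Proof.
move=> yr; have ABy := AB yr; case/andP: yr => y0 yr.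
have [A0 lipA] := pA; have [B0 lipB] := pB.
have /andP[l1 l2] := lipA _ _ (lexx 0) (ltW y0) yr.
(* The next height is sought in [[y/2, y]]: [B (y/2) <= 5/4 y < 3/2 y <= A y], and [A y < B y]. *)
have y20 : 0 <= y / 2 by lra.
have yy : y / 2 <= y by lra.
have yr2 : y / 2 < rho by lra.
have [|||c /andP[c1 c2] Bc] := @intermediate_value R B (y / 2) y (A y).
- exact: yy.
- by move=> x /andP[x1 x2]; apply: (profile_continuous pB); lra.
- apply/orP; left; rewrite (ltW ABy) andbT.
  have /andP[_ l3] := lipB _ _ (lexx 0) y20 yr2; lra.
exists c => //; apply/andP; split; first by lra.
rewrite lt_neqAle c2 andbT; apply/eqP => cy.
by move: ABy; rewrite -Bc cy ltxx.
Qed.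

(** [B y - A y] equals [B y - B y'], and 2/5 and 2/3 are the inverses of the extreme slopes of
    [B]. *)
Lemma step_gap y y' : 0 < y < rho -> 0 < y' < rho -> B y' = A y ->
  y' < y /\ 2 / 5 * (B y - A y) <= y - y' <= 2 / 3 * (B y - A y).
Proof.
move=> yr y'r E; have ABy := AB yr.
case/andP: yr => y0 yr; case/andP: y'r => y'0 y'r.
have [_ lipB] := pB.
have [yy'|y'y] := leP y y'.
  have /andP[l1 l2] := lipB _ _ (ltW y0) yy' y'r; exfalso; lra.
have /andP[l1 l2] := lipB _ _ (ltW y'0) (ltW y'y) yr.
by split=> //; lra.
Qed.

(** Heights bounded below by [tau] would decrease to a positive limit, where continuity gives
    [A = B], against [A < B]. *)
Lemma step_cvg0 (y : nat -> R) : (forall k, 0 < y k < rho) ->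
  (forall k, B (y k.+1) = A (y k)) ->
  forall tau, 0 < tau -> exists k, y k < tau.
Proof.
move=> yr E tau tau0; apply: contrapT => nex.
have ytau k : tau <= y k.
  by rewrite leNgt; apply/negP => yk; apply: nex; exists k.
have dec k : y k.+1 <= y k by have [/ltW] := step_gap (yr k) (yr k.+1) (E k).
have ni : nonincreasing_seq y by exact/nonincreasing_seqP.
have cy : cvgn y.
  by apply: nonincreasing_is_cvgn => //; exists tau => _ [k _ <-].
set l := limn y.
have ly k : l <= y k by exact: nonincreasing_cvgn_ge.
have taul : tau <= l by apply: limr_ge => //; near=> k; exact: ytau.
have lr : 0 < l < rho.
  have /andP[_ y0r] := yr 0%N.
  by rewrite (lt_le_trans tau0 taul) (le_lt_trans (ly 0%N) y0r).
have cA : A (y k) @[k --> \oo] --> A l.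
  by apply: cvg_comp cy _; exact: profile_continuous pA lr.
have cB : B (y k.+1) @[k --> \oo] --> B l.
  apply: (@cvg_comp _ _ _ (fun k => y k.+1) B _ (nbhs l)).
    by rewrite cvg_shiftS.
  exact: profile_continuous pB lr.
have : A l = B l.
  apply: (@cvg_unique _ _ (A (y k) @[k --> \oo])) => //.
  by move: cB; under eq_fun do rewrite E.
by have := AB lr => + E'; rewrite E' ltxx.
Unshelve. all: by end_near. Qed.

Lemma step_orbit y0 : 0 < y0 < rho -> exists y : nat -> R,
  [/\ y 0%N = y0, forall k, 0 < y k < rho & forall k, B (y k.+1) = A (y k)].
Proof.
move=> y0r.
have /choice[f Hf] : forall y, exists y', 0 < y < rho ->
    0 < y' < rho /\ B y' = A y.
  move=> y; have [yr|nyr] := boolP (0 < y < rho); last by exists 0.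
  have [y' /andP[y'0 y'y] E] := step_exists yr.
  exists y' => _; split=> //; rewrite y'0 (lt_trans y'y)//.
  by case/andP: yr.
pose y k := iter k f y0.
have yr k : 0 < y k < rho by elim: k => // k /Hf[].
by exists y; split=> // k; have [] := Hf _ (yr k).
Qed.

End Step.

(** * Area of neighborhoods *)

Section Area.
Context {R : realType}.
Local Open Scope ereal_scope.
Notation lambda := (@lebesgue_measure R).

Lemma area_ysection (A : set (R * R)) : measurable A ->
  area A = \int[lambda]_y lambda (ysection A y).
Proof.
move=> mA; have := @indic_fubini_tonelli _ _ _ _ R lambda lambda A mA.
by rewrite indic_fubini_tonelli_FE// indic_fubini_tonelli_GE.
Qed.

Lemma measurable_disc (a : R * R) (e : R) :
  measurable [set q : R * R |
    (Num.sqrt ((q.1 - a.1) ^+ 2 + (q.2 - a.2) ^+ 2) < e)%R].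
Proof.
have mf : measurable_fun setT (fun q : R * R =>
    Num.sqrt ((q.1 - a.1) ^+ 2 + (q.2 - a.2) ^+ 2))%R.
  apply: (@measurableT_comp _ _ _ _ _ _ (@Num.sqrt R)).
    exact: (continuous_measurable_fun (@sqrt_continuous R)).
  apply: measurable_funD; apply: measurable_funX; apply: measurable_funB;
    [exact: measurable_fst|exact: measurable_cst|exact: measurable_snd|exact: measurable_cst].
rewrite (_ : [set q | _] = [set: R * R] `&`
   (fun q : R * R => Num.sqrt ((q.1 - a.1) ^+ 2 + (q.2 - a.2) ^+ 2))%R @^-1` `]-oo, e[%classic).
  exact: mf.
by rewrite setTI; apply/seteqP; split => q /=; rewrite in_itv.
Qed.

Lemma measurable_euclidean_nbhd (s : nat -> R * R) (e : R) :
  measurable (euclidean_nbhd (range s) e).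
Proof.
rewrite (_ : euclidean_nbhd _ _ = \bigcup_k [set q : R * R |
    (Num.sqrt ((q.1 - (s k).1) ^+ 2 + (q.2 - (s k).2) ^+ 2) < e)%R]).
  by apply: bigcupT_measurable => k; exact: measurable_disc.
apply/seteqP; split => q.
- by move=> [_ [k _ <-] qk]; exists k.
- by move=> [k _ qk]; exists (s k) => //; exists k.
Qed.

Lemma sqrt_sum_sqr_ge (u v e : R) : (Num.sqrt (u ^+ 2 + v ^+ 2) < e)%R ->
  (`|u| < e /\ `|v| < e)%R.
Proof.
move=> uve; split; apply: le_lt_trans uve; rewrite -sqrtr_sqr ler_wsqrtr//.
  by rewrite lerDl sqr_ge0.
by rewrite lerDr sqr_ge0.
Qed.

Lemma sqrt_sum_sqr_lt (u v e : R) : (`|u| < e / 2)%R -> (`|v| < e / 2)%R ->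
  (Num.sqrt (u ^+ 2 + v ^+ 2) < e)%R.
Proof.
move=> ue ve; have u0 := normr_ge0 u; have v0 := normr_ge0 v.
have e0 : (0 < e)%R by lra.
rewrite -[ltRHS](gtr0_norm e0) -sqrtr_sqr ltr_sqrt ?exprn_gt0//.
rewrite -[(u ^+ 2)%R]real_normK ?num_real// -[(v ^+ 2)%R]real_normK ?num_real//.
have u2 : (`|u| ^+ 2 <= (e / 2) ^+ 2)%R by rewrite ler_pXn2r ?nnegrE//; lra.
have v2 : (`|v| ^+ 2 <= (e / 2) ^+ 2)%R by rewrite ler_pXn2r ?nnegrE//; lra.
have e2 : (0 < e ^+ 2)%R by rewrite exprn_gt0.
by move: u2 v2; rewrite expr_div_n; lra.
Qed.

(** Each horizontal slice at a height in []0, t[] contains an interval of length [e] about the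
    abscissa of a nearby point, because a square of half-side e/2 fits in the disc of radius [e]. *)
Lemma area_nbhd_ge (s : nat -> R * R) (e t : R) : (0 < e)%R -> (0 <= t)%R ->
  (forall y, 0 < y < t -> exists k, `|y - (s k).2| < e / 2)%R ->
  (e * t)%:E <= area (euclidean_nbhd (range s) e).
Proof.
move=> e0 t0 near_y; have mN := measurable_euclidean_nbhd s e.
rewrite area_ysection//.
have mI : measurable (`]0%R, t[%classic : set R) by exact: measurable_itv.
have -> : (e * t)%:E = \int[lambda]_(y in `]0%R, t[) (e%:E).
  rewrite integral_cst//= lebesgue_measure_itv/= lte_fin.
  by case: ltP => [_|t0']; rewrite ?oppr0 ?addr0 -?EFinM ?sube0//;
    have -> : t = 0%R by apply/eqP; rewrite eq_le t0' t0.
apply: (@le_trans _ _ (\int[lambda]_(y in `]0%R, t[)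
    lambda (ysection (euclidean_nbhd (range s) e) y))).
  apply: ge0_le_integral => //.
  - by move=> y _; rewrite lee_fin ltW.
  - by apply: measurable_funS (measurable_fun_ysection lambda mN).
  move=> y; rewrite /= in_itv/= => /near_y[k yk].
  apply: (@le_trans _ _ (lambda `]((s k).1 - e / 2)%R, ((s k).1 + e / 2)%R[%classic)).
    rewrite lebesgue_measure_itv/= lte_fin ifT; last by lra.
    by rewrite -EFinB lee_fin; lra.
  apply: le_measure.
  - by rewrite inE; exact: measurable_itv.
  - by rewrite inE; exact: measurable_ysection.
  move=> x /=; rewrite in_itv/= => /andP[x1 x2]; rewrite /ysection/= inE.
  exists (s k) => /=; first by exists k.
  by apply: sqrt_sum_sqr_lt => //; rewrite ltr_norml; apply/andP; split; lra.
apply: ge0_subset_integral => //.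
exact: measurable_fun_ysection.
Qed.

(** Points whose discs meet the same horizontal slice differ in height by at most 2e, hence in
    abscissa by at most 2Ke. Adding a radius [e] at both ends, the slice stays within (2K+2)e of one
    abscissa. *)
Lemma area_nbhd_le (s : nat -> R * R) (K e : R) (Y : set R) :
  (0 <= K)%R -> (0 < e)%R ->
  (forall k k', `|(s k).1 - (s k').1| <= K * `|(s k).2 - (s k').2|)%R ->
  measurable Y -> (forall k y, `|y - (s k).2| < e -> Y y)%R ->
  area (euclidean_nbhd (range s) e) <= ((4 * K + 4) * e)%:E * lambda Y.
Proof.
move=> K0 e0 lip mY sY; have mN := measurable_euclidean_nbhd s e.
rewrite area_ysection//; set c := ((4 * K + 4) * e)%R.
have c0 : (0 <= c)%R by apply: mulr_ge0; lra.
have -> : c%:E * lambda Y = \int[lambda]_(y in Y) c%:E by rewrite integral_cst.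
rewrite [leRHS]integral_mkcond.
apply: ge0_le_integral => //.
- exact: measurable_fun_ysection.
- by apply/(measurable_restrict _ mY measurableT); exact: measurable_cst.
move=> y _; rewrite patchE.
have [[x [a [k _ sk] /sqrt_sum_sqr_ge[/= xk yk]]]|noy] := pselect (exists x,
    euclidean_nbhd (range s) e (x, y)); last first.
  rewrite (_ : ysection _ y = set0) ?measure0; last first.
    by apply/seteqP; split => x //; rewrite /ysection/= inE => xy; apply: noy; exists x.
  by case: ifPn.
rewrite -sk in xk yk.
rewrite ifT; last by rewrite inE; exact: sY yk.
apply: (@le_trans _ _ (lambda `[((s k).1 - c / 2)%R, ((s k).1 + c / 2)%R]%classic)).
  apply: le_measure.
  - by rewrite inE; exact: measurable_ysection.
  - by rewrite inE; exact: measurable_itv.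
  move=> x'; rewrite /ysection/= inE => -[_ [k' _ <-] /sqrt_sum_sqr_ge[/= xk' yk']].
  have yy : (`|(s k').2 - (s k).2| <= 2 * e)%R.
    by move: yk yk'; rewrite ler_norml !ltr_norml => /andP[? ?] /andP[? ?]; apply/andP; split; lra.
  have xx := le_trans (lip k' k) (ler_wpM2l K0 yy).
  rewrite in_itv/=; move: xx xk'; rewrite ler_norml ltr_norml /c => /andP[? ?] /andP[? ?].
  by apply/andP; split; lra.
rewrite lebesgue_measure_itv/= lte_fin; case: ifP => _; last by rewrite lee_fin.
by rewrite -EFinB lee_fin; lra.
Qed.

Lemma finite_cover_measure (y : nat -> R) (t e : R) (n : nat) : (0 < e)%R ->
  (0 < t)%R -> exists Y : set R,
  [/\ measurable Y, lambda Y <= (t + 2 * e + n%:R * (2 * e))%:E,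
      (forall u, - e <= u <= t + e -> Y u)%R &
      (forall k u, (k < n)%N -> `|u - y k| < e -> Y u)%R].
Proof.
move=> e0 t0; elim: n => [|n [Y [mY lY Yt Yn]]].
  exists `[(- e)%R, (t + e)%R]%classic; split.
  - exact: measurable_itv.
  - rewrite lebesgue_measure_itv/= lte_fin ifT; last by lra.
    by rewrite -EFinB lee_fin; lra.
  - by move=> u ut; rewrite /= in_itv.
  - by [].
exists (Y `|` `[(y n - e)%R, (y n + e)%R]%classic); split.
- by apply: measurableU => //; exact: measurable_itv.
- have I2e : lambda `[(y n - e)%R, (y n + e)%R]%classic <= (2 * e)%:E.
    rewrite lebesgue_measure_itv/= lte_fin ifT; last by lra.
    by rewrite -EFinB lee_fin; lra.
  apply: le_trans.
    by apply: (measureU2 lambda mY); exact: measurable_itv.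
  apply: le_trans (leeD lY I2e) _.
  by rewrite -EFinD lee_fin -natr1; lra.
- by move=> u /Yt; left.
- move=> k u; rewrite ltnS leq_eqVlt => /orP[/eqP ->|kn] uk.
    right; rewrite /= in_itv/=; move: uk; rewrite ltr_norml => /andP[? ?].
    by apply/andP; split; lra.
  by left; exact: Yn kn uk.
Qed.

End Area.

(** * Minkowski dimension *)

Section BoxDim.
Context {R : realType}.
Implicit Types (A : set (R * R)) (d r : R).

Lemma content_ratio_ge0 r A e : (0 <= content_ratio r A e)%E.
Proof.
by rewrite mule_ge0// lee_fin invr_ge0 powR_ge0.
Qed.

Lemma at_right0_meet (V W : set R) : (0:R)^'+ V -> (0:R)^'+ W ->
  exists2 e : R, V e & W e.
Proof. by move=> FV FW; have [e [Ve We]] := filter_ex (filterI FV FW); exists e. Qed.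

Lemma ereal_inf_critical (c : R -> \bar R) d : 0 <= d ->
  (forall r, d < r -> c r = 0%E) -> (forall r, 0 <= r -> r < d -> c r != 0%E) ->
  ereal_inf [set r%:E | r in [set r | 0 <= r /\ c r = 0%E]] = d%:E.
Proof.
move=> d0 c0 cn0; apply/eqP; rewrite eq_le; apply/andP; split.
- apply/lee_addgt0Pr => e e0; apply: ereal_inf_lbound.
  exists (d + e); last by rewrite EFinD.
  by split; [rewrite addr_ge0// ltW|rewrite c0// ltrDl].
- apply: le_ereal_inf_tmp => _ [r [r0 cr] <-]; rewrite lee_fin leNgt; apply/negP => rd.
  by have := cn0 _ r0 rd; rewrite cr eqxx.
Qed.

(** The upper bound makes the content ratio at [r > d] at most a constant times [e^(r - d)]; the
    lower one keeps it away from 0 at [r < d]. Both hold for all small [e], so they decide limsup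
    and liminf alike. The lower bound is asked only strictly below [d], where the flat case provides
    it. *)
Lemma has_box_dim_area A d : 0 <= d ->
  (exists C : R, \forall e \near (0:R)^'+,
    (area (euclidean_nbhd A e) <= (C * e `^ (2 - d))%:E)%E) ->
  (forall r, 0 <= r -> r < d -> exists2 c : R, 0 < c & \forall e \near (0:R)^'+,
    ((c * e `^ (2 - r))%:E <= area (euclidean_nbhd A e))%E) ->
  has_box_dim A d.
Proof.
move=> d0 [C Cup] lo.
have small r eta : d < r -> 0 < eta -> \forall e \near (0:R)^'+,
    (content_ratio r A e <= eta%:E)%E.
  move=> dr eta0; pose C' := `|C| + 1.
  have C'0 : 0 < C' by rewrite ltr_pwDr.
  have rd0 : r - d != 0 by rewrite subr_eq0 gt_eqF.
  have rdp : 0 < r - d by rewrite subr_gt0.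
  near=> e.
  have e0 : 0 < e by near: e; exact: nbhs_right_gt.
  have ee : e < (eta / C') `^ (r - d)^-1.
    by near: e; apply: nbhs_right_lt; apply: powR_gt0; apply: divr_gt0.
  have up : (area (euclidean_nbhd A e) <= (C * e `^ (2 - d))%:E)%E by near: e.
  have pe : 0 < e `^ (2 - r) by rewrite powR_gt0.
  rewrite /content_ratio lee_pdivrMr// -EFinM.
  apply: le_trans up _; rewrite lee_fin.
  have -> : 2 - d = (r - d) + (2 - r) by ring.
  rewrite powRD; last by rewrite (gt_eqF e0) implybT.
  rewrite mulrA ler_wpM2r ?powR_ge0//.
  have h1 : e `^ (r - d) <= eta / C'.
    have -> : eta / C' = ((eta / C') `^ (r - d)^-1) `^ (r - d).
      by rewrite -powRrM mulVf// powRr1// divr_ge0// ltW.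
    by apply: ge0_ler_powR; rewrite ?nnegrE ?powR_ge0// ltW.
  apply: (@le_trans _ _ (C' * e `^ (r - d))).
    by rewrite ler_wpM2r ?powR_ge0// /C' (le_trans (ler_norm C))// lerDl.
  by apply: le_trans (ler_wpM2l (ltW C'0) h1) _; rewrite mulrC divfK// gt_eqF.
have large r : 0 <= r -> r < d -> exists2 c : R, 0 < c &
    \forall e \near (0:R)^'+, (c%:E <= content_ratio r A e)%E.
  move=> r0 rd; have [c c0 low] := lo _ r0 rd; exists c => //.
  near=> e.
  have e0 : 0 < e by near: e; exact: nbhs_right_gt.
  rewrite /content_ratio lee_pdivlMr ?powR_gt0// -EFinM.
  by near: e.
split; apply: ereal_inf_critical => // r.
- move=> dr; apply/eqP; rewrite eq_le; apply/andP; split; last first.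
    by apply: limf_esup_ge0; [apply: filter_not_empty|move=> e; exact: content_ratio_ge0].
  apply/lee_addgt0Pr => eta eta0; rewrite add0e.
  apply: ge_ereal_inf; eexists.
    by exists [set e | (content_ratio r A e <= eta%:E)%E]; [exact: small|reflexivity].
  by apply: ge_ereal_sup => _ [e ? <-].
- move=> r0 rd; have [c c0 Hc] := large _ r0 rd.
  rewrite gt_eqF //; rewrite -lte_fin in c0; apply: lt_le_trans c0 _.
  apply: le_ereal_inf_tmp => _ [V FV <-].
  have [e Ve ce] := at_right0_meet FV Hc.
  by apply: le_trans ce _; apply: ereal_sup_ubound; exists e.
- move=> dr; rewrite /lower_content limf_einfE; apply/eqP; rewrite eq_le; apply/andP; split.
    apply/lee_addgt0Pr => eta eta0; rewrite add0e.
    apply: ge_ereal_sup => _ [V FV <-].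
    have [e Ve ce] := at_right0_meet FV (small _ _ dr eta0).
    by apply: le_trans ce; apply: ereal_inf_lbound; exists e.
  apply: le_ereal_sup_tmp; eexists.
    by exists setT; [exact: filterT|reflexivity].
  by apply: le_ereal_inf_tmp => _ [e _ <-]; exact: content_ratio_ge0.
- move=> r0 rd; have [c c0 Hc] := large _ r0 rd.
  rewrite gt_eqF //; rewrite -lte_fin in c0; apply: lt_le_trans c0 _.
  rewrite /lower_content limf_einfE; apply: le_ereal_sup_tmp; eexists.
    by exists [set e | (c%:E <= content_ratio r A e)%E]; [exact: Hc|reflexivity].
  by apply: le_ereal_inf_tmp => _ [e ? <-].
Unshelve. all: by end_near. Qed.

End BoxDim.

(** * Decreasing sequences whose gaps compare with a power of their terms *)

Section GapSequence.
Context {R : realType} (y : nat -> R) (mu : R).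
Hypotheses (y_gt0 : forall k, 0 < y k) (y_dec : forall k, y k.+1 < y k)
  (mu_gt1 : 1 < mu).

Lemma gap_sequence_noninc : {homo y : k k' / (k <= k')%N >-> k' <= k}.
Proof. by apply/nonincreasing_seqP => k; exact: ltW. Qed.

(** Let [y k.+1] be the first term not above [u]. Once gaps are at most half the term, [y k <= 2 u],
    so the gap around [u] is at most [C (2 u)^mu], which is at most e/4 by the choice of [c]. *)
Lemma dense_below (C y1 : R) : 0 < C -> 0 < y1 ->
  (forall tau, 0 < tau -> exists k, y k < tau) ->
  (forall k, y k < y1 -> y k - y k.+1 <= C * y k `^ mu) ->
  exists2 c : R, 0 < c & \forall e \near (0:R)^'+,
    forall u, 0 < u < c * e `^ mu^-1 -> exists k, `|u - y k| < e / 2.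
Proof.
move=> C0 y10 y0 gap.
have mu1 := mu_gt1; have mu0 : 0 < mu by lra.
have mum1 : 0 < mu - 1 by lra.
(* The second bound is where [C t^mu = t / 2]. *)
pose y2 := Num.min y1 ((2 * C)^-1 `^ (mu - 1)^-1).
have C20 : 0 < (2 * C)^-1 by rewrite invr_gt0 mulr_gt0.
have y20 : 0 < y2 by rewrite lt_min y10 powR_gt0.
have half t : 0 < t -> t < y2 -> C * t `^ mu <= t / 2.
  move=> t0; rewrite lt_min => /andP[_ t2].
  have h1 : t `^ (mu - 1) <= (2 * C)^-1.
    have -> : (2 * C)^-1 = ((2 * C)^-1 `^ (mu - 1)^-1) `^ (mu - 1).
      by rewrite -powRrM mulVf ?gt_eqF// powRr1// ltW.
    by apply: ge0_ler_powR; rewrite ?nnegrE ?powR_ge0// ltW.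
  have -> : mu = (mu - 1) + 1 by ring.
  rewrite powRD; last by rewrite (gt_eqF t0) implybT.
  rewrite powRr1 ?(ltW t0)// mulrA [X in _ <= X]mulrC ler_wpM2r ?(ltW t0)//.
  apply: le_trans (ler_wpM2l (ltW C0) h1) _.
  by rewrite invfM mulrCA divff ?mulr1// gt_eqF.
have [K0 yK0] := y0 _ y20.
(* Chosen so that [C (2 c)^mu = 1/4]. *)
pose c := 2^-1 * (4 * C)^-1 `^ mu^-1.
have C40 : 0 < (4 * C)^-1 by rewrite invr_gt0 mulr_gt0.
have c0 : 0 < c by rewrite mulr_gt0 ?invr_gt0 ?powR_gt0.
have cmu : (2 * c) `^ mu = (4 * C)^-1.
  rewrite /c mulrA divff ?mul1r ?pnatr_eq0// -powRrM mulVf ?gt_eqF// powRr1//.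
  exact: ltW.
exists c => //; near=> e.
have e0 : 0 < e by near: e; exact: nbhs_right_gt.
(* This keeps [u] below [y K0], so the index found is past [K0] and its term is below [y2]. *)
have ee : e < (y K0 / c) `^ mu.
  by near: e; apply: nbhs_right_lt; apply: powR_gt0; apply: divr_gt0.
have ce : c * e `^ mu^-1 <= y K0.
  have h1 : e `^ mu^-1 <= y K0 / c.
    have -> : y K0 / c = ((y K0 / c) `^ mu) `^ mu^-1.
      by rewrite -powRrM divff ?gt_eqF// powRr1// divr_ge0// ltW.
    by apply: ge0_ler_powR; rewrite ?nnegrE ?powR_ge0 ?invr_ge0// ltW.
  by apply: le_trans (ler_wpM2l (ltW c0) h1) _; rewrite mulrC divfK// gt_eqF.
move=> u /andP[u0 ue].
have uK : u < y K0 by exact: lt_le_trans ue ce.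
have ex : exists k, y k <= u by have [k /ltW ?] := y0 _ u0; exists k.
have [[|k] yk kmin] := ex_minnP ex.
  by have := gap_sequence_noninc (leq0n K0); lra.
have yk' : u < y k by rewrite ltNge; apply/negP => /kmin; rewrite ltnn.
have Kk : (K0 <= k)%N.
  rewrite leqNgt; apply/negP => kK; have := gap_sequence_noninc kK; lra.
have yk2 : y k < y2 by apply: le_lt_trans yK0; exact: gap_sequence_noninc.
have g1 : y k - y k.+1 <= C * y k `^ mu.
  by apply: gap; move: yk2; rewrite lt_min => /andP[].
have g2 := half _ (y_gt0 k) yk2.
have yk2u : y k <= 2 * u by lra.
have g3 : C * y k `^ mu <= e / 4.
  apply: (@le_trans _ _ (C * ((4 * C)^-1 * e))).
    apply: ler_wpM2l; first exact: ltW.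
    have -> : (4 * C)^-1 * e = (2 * c * e `^ mu^-1) `^ mu.
      have c20 : 0 <= 2 * c by rewrite mulr_ge0// ltW.
      rewrite (powRM _ c20 (powR_ge0 _ _)) cmu; congr (_ * _).
      by rewrite -powRrM mulVf ?gt_eqF// powRr1// ltW.
    apply: ge0_ler_powR; rewrite ?nnegrE ?(ltW mu0) ?(ltW (y_gt0 k))//.
      by rewrite mulr_ge0 ?powR_ge0// mulr_ge0// ltW.
    by rewrite -mulrA; lra.
  by rewrite invfM mulrA mulrCA divff ?mulr1 1?mulrC// gt_eqF.
by exists k.+1; rewrite ger0_norm; lra.
Unshelve. all: by end_near. Qed.

(** The convex function [t^(1 - mu)] lies above its tangent at [b]. With [s = a / b] this is
    [exp x >= 1 + x] combined with [ln s <= s - 1]. *)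
Lemma powR_gap (a b : R) : 0 < a -> a < b ->
  (mu - 1) * b `^ (- mu) * (b - a) <= a `^ (1 - mu) - b `^ (1 - mu).
Proof.
move=> a0 ab; have b0 : 0 < b by exact: lt_trans ab.
pose s := a / b; have s0 : 0 < s by rewrite divr_gt0.
have h : 1 + (mu - 1) * (1 - s) <= s `^ (1 - mu).
  rewrite /powR gt_eqF//; apply: le_trans (expR_ge1Dx _).
  have lns : ln s <= s - 1.
    have E : 1 + (s - 1) = s by ring.
    by have := @le_ln1Dx R (s - 1); rewrite E; apply; lra.
  have mu1 := mu_gt1; rewrite lerD2l.
  have -> : (1 - mu) * ln s = (mu - 1) * - ln s by ring.
  by apply: ler_wpM2l; lra.
have -> : a `^ (1 - mu) = s `^ (1 - mu) * b `^ (1 - mu).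
  by rewrite -powRM ?(ltW s0) ?(ltW b0)// /s divfK// gt_eqF.
have bE : b `^ (1 - mu) = b `^ (- mu) * b.
  rewrite powRD; last by rewrite (gt_eqF b0) implybT.
  by rewrite powRr1 1?mulrC// ltW.
have sb : s * b = a by rewrite /s divfK// gt_eqF.
have bp : 0 <= b `^ (- mu) * b by rewrite mulr_ge0 ?powR_ge0// ltW.
rewrite bE.
have := ler_wpM2r bp h.
have -> : (1 + (mu - 1) * (1 - s)) * (b `^ (- mu) * b) =
  b `^ (- mu) * b + (mu - 1) * b `^ (- mu) * (b - s * b) by ring.
by rewrite sb; lra.
Qed.

(* y_k ^ (1 - mu) grows at least linearly in k, which bounds the number of
   terms above a given height. *)
Lemma index_bound (c : R) : 0 < c ->
  (forall k, c * y k `^ mu <= y k - y k.+1) ->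
  forall k, k%:R * (c * (mu - 1)) <= y k `^ (1 - mu).
Proof.
move=> c0 gap; elim=> [|k IH]; first by rewrite mul0r powR_ge0.
rewrite -natr1 mulrDl mul1r.
have g := powR_gap (y_gt0 k.+1) (y_dec k).
have : c * (mu - 1) <= (mu - 1) * y k `^ (- mu) * (y k - y k.+1).
  rewrite mulrC -mulrA; apply: ler_wpM2l; first by have mu1 := mu_gt1; lra.
  apply: le_trans (ler_wpM2l (powR_ge0 _ _) (gap k)).
  rewrite mulrCA -powRD; last by rewrite (gt_eqF (y_gt0 k)) implybT.
  by rewrite addNr powRr0 mulr1.
by lra.
Qed.

(* Above the height tau = e ^ (1 / mu) the terms are few, below it they are
   covered by a single interval. *)
Lemma cover_measure (c : R) : 0 < c ->
  (forall k, c * y k `^ mu <= y k - y k.+1) ->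
  exists C : R, \forall e \near (0:R)^'+, exists Y : set R,
    [/\ measurable Y, (@lebesgue_measure R Y <= (C * e `^ mu^-1)%:E)%E &
        forall k u, `|u - y k| < e -> Y u].
Proof.
move=> c0 gap; have mu1 := mu_gt1; have mu0 : 0 < mu by lra.
have mum1 : 0 < mu - 1 by lra.
have cm0 : 0 < c * (mu - 1) by rewrite mulr_gt0.
(* The cover has length at most [tau + 2e + 2e(B + 1)], where [e <= tau] and
   [e B = tau / (c (mu - 1))]. *)
exists (5 + 2 / (c * (mu - 1))); near=> e.
have e0 : 0 < e by near: e; exact: nbhs_right_gt.
have e1 : e < 1 by near: e; exact: nbhs_right_lt.
pose tau := e `^ mu^-1; have tau0 : 0 < tau by rewrite powR_gt0.
pose B := tau `^ (1 - mu) / (c * (mu - 1)).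
have B0 : 0 <= B by rewrite divr_ge0 ?powR_ge0// ltW.
pose n := (Num.truncn B).+1.
have Bn : B < n%:R by rewrite /n truncnS_gt.
have nB : n%:R <= B + 1 by rewrite /n -natr1 lerD2r truncn_le.
have far k : (n <= k)%N -> y k <= tau.
  move=> nk; rewrite leNgt; apply/negP => tk.
  have ib := index_bound c0 gap k.
  have : y k `^ (1 - mu) <= tau `^ (1 - mu).
    have -> : 1 - mu = - (mu - 1) by ring.
    rewrite !powRN lef_pV2 ?posrE ?powR_gt0//.
    by apply: ge0_ler_powR; rewrite ?nnegrE ltW.
  move=> /(le_trans ib); rewrite -ler_pdivlMr// -/B leNgt => /negP; apply.
  by apply: lt_le_trans Bn _; rewrite ler_nat.
have [Y [mY lY Yt Yn]] := @finite_cover_measure R y tau e n e0 tau0.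
exists Y; split=> //.
- apply: le_trans lY _; rewrite lee_fin.
  have etau : e <= tau.
    apply: ger1_powR; first by rewrite e0 ltW.
    by rewrite invf_le1// ltW.
  have eB : e * B = tau / (c * (mu - 1)).
    rewrite /B mulrA; congr (_ / _).
    rewrite /tau -powRrM -{1}[e]powRr1 ?(ltW e0)// -powRD; last by rewrite (gt_eqF e0) implybT.
    by congr (_ `^ _); field; rewrite gt_eqF.
  have : n%:R * (2 * e) <= (B + 1) * (2 * e) by apply: ler_wpM2r => //; lra.
  have E : (5 + 2 / (c * (mu - 1))) * tau = 5 * tau + 2 * (e * B).
    by rewrite eB; ring.
  rewrite -/tau E => nB'; lra.
- move=> k u uk; have [kn|nk] := ltnP k n; first exact: Yn kn uk.
  apply: Yt; have := far _ nk; have := y_gt0 k; move: uk.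
  by rewrite ltr_norml => /andP[? ?] ? ?; apply/andP; split; lra.
Unshelve. all: by end_near. Qed.

End GapSequence.

Section OrbitDimension.
Context {R : realType} (s : nat -> R * R) (K : R).
Hypotheses (K_ge0 : 0 <= K)
  (s_lip : forall k k', `|(s k).1 - (s k').1| <= K * `|(s k).2 - (s k').2|)
  (s_gt0 : forall k, 0 < (s k).2) (s_dec : forall k, (s k.+1).2 < (s k).2)
  (s_cvg0 : forall tau, 0 < tau -> exists k, (s k).2 < tau).

Lemma area_ge_of_gaps (mu C y1 r : R) : 1 < mu -> 0 < C -> 0 < y1 ->
  (forall k, (s k).2 < y1 -> (s k).2 - (s k.+1).2 <= C * (s k).2 `^ mu) ->
  r <= 1 - mu^-1 ->
  exists2 c : R, 0 < c & \forall e \near (0:R)^'+,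
    ((c * e `^ (2 - r))%:E <= area (euclidean_nbhd (range s) e))%E.
Proof.
move=> mu1 C0 y10 gap rmu.
have [c c0 dense] := dense_below s_gt0 s_dec mu1 C0 y10 s_cvg0 gap.
exists c => //; near=> e.
have e0 : 0 < e by near: e; exact: nbhs_right_gt.
have e1 : e < 1 by near: e; exact: nbhs_right_lt.
have ce0 : 0 <= c * e `^ mu^-1 by rewrite mulr_ge0 ?powR_ge0// ltW.
have dense_e : forall u, 0 < u < c * e `^ mu^-1 -> exists k, `|u - (s k).2| < e / 2.
  by near: e.
apply: le_trans (area_nbhd_ge e0 ce0 dense_e).
rewrite lee_fin mulrCA; apply: ler_wpM2l; first exact: ltW.
rewrite -{2}[e]powRr1 ?(ltW e0)// -powRD; last by rewrite (gt_eqF e0) implybT.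
by apply: ger_powR; [rewrite e0 ltW|lra].
Unshelve. all: by end_near. Qed.

Lemma has_box_dim_of_gaps (mu c C : R) : 1 < mu -> 0 < c -> 0 < C ->
  (forall k, c * (s k).2 `^ mu <= (s k).2 - (s k.+1).2 <= C * (s k).2 `^ mu) ->
  has_box_dim (range s) (1 - mu^-1).
Proof.
move=> mu1 c0 C0 gap.
have mui : mu^-1 < 1 by rewrite invf_lt1//; lra.
apply: has_box_dim_area; first by lra.
- have [|Cy coverY] := cover_measure s_gt0 s_dec mu1 c0.
    by move=> k; have /andP[] := gap k.
  exists ((4 * K + 4) * Cy); near=> e.
  have e0 : 0 < e by near: e; exact: nbhs_right_gt.
  have [Y [mY lY sY]] : exists Y : set R,
    [/\ measurable Y, (@lebesgue_measure R Y <= (Cy * e `^ mu^-1)%:E)%E &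
        forall k u, `|u - (s k).2| < e -> Y u] by near: e.
  apply: le_trans (area_nbhd_le K_ge0 e0 s_lip mY sY) _.
  have K4 : 0 <= (4 * K + 4) * e.
    by apply: mulr_ge0; [have := K_ge0; lra|exact: ltW].
  apply: le_trans (lee_wpmul2l _ lY) _; first by rewrite lee_fin.
  rewrite -EFinM lee_fin.
  have -> : 2 - (1 - mu^-1) = 1 + mu^-1 by ring.
  rewrite powRD; last by rewrite (gt_eqF e0) implybT.
  rewrite powRr1 ?(ltW e0)//.
  suff -> : (4 * K + 4) * e * (Cy * e `^ mu^-1) = (4 * K + 4) * Cy * (e * e `^ mu^-1) by [].
  by ring.
- move=> r r0 rd; apply: (area_ge_of_gaps mu1 C0 ltr01) => [k _|]; last exact: ltW.
  by have /andP[] := gap k.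
Unshelve. all: by end_near. Qed.

(** All heights lie in a bounded interval, so the Lipschitz graph gives an area of order [e]. For
    [r < 1] the exponent [mu = 1 / (1 - r)] satisfies [1 - 1/mu = r]. *)
Lemma has_box_dim1_of_gaps :
  (forall mu, 1 < mu -> exists2 C : R, 0 < C & exists2 y1 : R, 0 < y1 &
    forall k, (s k).2 < y1 -> (s k).2 - (s k.+1).2 <= C * (s k).2 `^ mu) ->
  has_box_dim (range s) 1.
Proof.
move=> gap; apply: has_box_dim_area => //.
- exists ((4 * K + 4) * ((s 0%N).2 + 2)); near=> e.
  have e0 : 0 < e by near: e; exact: nbhs_right_gt.
  have e1 : e < 1 by near: e; exact: nbhs_right_lt.
  have y00 := s_gt0 0%N.
  have mY : measurable (`[(- 1)%R, ((s 0%N).2 + 1)%R]%classic : set R) by exact: measurable_itv.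
  have sY k u : `|u - (s k).2| < e -> (`[(- 1)%R, ((s 0%N).2 + 1)%R]%classic : set R) u.
    rewrite ltr_norml => /andP[u1 u2]; rewrite /= in_itv/=.
    have := gap_sequence_noninc s_dec (leq0n k); have := s_gt0 k => *.
    by apply/andP; split; lra.
  apply: le_trans (area_nbhd_le K_ge0 e0 s_lip mY sY) _.
  rewrite lebesgue_measure_itv/= lte_fin ifT; last by lra.
  have -> : (2 - 1 : R) = 1 by ring.
  rewrite powRr1 ?(ltW e0)// -EFinB -EFinM lee_fin.
  suff -> : (4 * K + 4) * e * ((s 0%N).2 + 1 - - 1) = (4 * K + 4) * ((s 0%N).2 + 2) * e by [].
  by ring.
(* Raising [r] to at least 1/2 keeps [mu > 1] when [r = 0]. *)
- move=> r r0 r1; pose r' := Num.max r 2^-1.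
  have r'1 : r' < 1 by rewrite gt_max r1/=; lra.
  have rr' : r <= r' by rewrite le_max lexx.
  have r'2 : 2^-1 <= r' by rewrite le_max lexx orbT.
  have mu1 : 1 < (1 - r')^-1 by rewrite invf_gt1; lra.
  have [C C0 [y1 y10 gapk]] := gap _ mu1.
  by apply: (area_ge_of_gaps mu1 C0 y10 gapk); rewrite invrK; lra.
Unshelve. all: by end_near. Qed.

End OrbitDimension.

(** * Slow orbits on an arbitrary section and the resulting codimension *)

Lemma profile_restrict {R : realType} (rho rho' : R) (J : R -> R) :
  rho' <= rho -> bilipschitz_profile rho J -> bilipschitz_profile rho' J.
Proof.
move=> rr [J0 lip]; split; first by [].
move=> y y' y0 yy' yr.
exact: lip (lt_le_trans yr rr).
Qed.

Section FractalCodimension.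
Context {R : realType} (F : R -> R) (rho : R) (J L : R -> R) (c : option nat).
Hypotheses (rho_gt0 : 0 < rho) (pJ : bilipschitz_profile rho J)
  (pL : bilipschitz_profile rho L)
  (divE : forall p q, 0 < p.2 < rho -> 0 < q.2 < rho ->
    slow_divergence F p q = J q.2 - L p.2)
  (div_neq0 : forall y, 0 < y < rho -> J y - L y != 0)
  (dims : forall (s : nat -> R * R) (K : R), 0 <= K ->
    (forall k k', `|(s k).1 - (s k').1| <= K * `|(s k).2 - (s k').2|) ->
    (forall k, 0 < (s k).2 < rho) -> (forall k, (s k.+1).2 < (s k).2) ->
    (forall tau, 0 < tau -> exists k, (s k).2 < tau) ->
    (forall k, 2 / 5 * `|J (s k).2 - L (s k).2| <= (s k).2 - (s k.+1).2
               <= 2 / 3 * `|J (s k).2 - L (s k).2|) ->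
    exists2 d, has_box_dim (range s) d & codim_of_dim d c).

Lemma orbit_on_section (sigma : set (R * R)) (rho' : R) (A B : R -> R)
    (p0 : R * R) :
  bilipschitz_profile rho' A -> bilipschitz_profile rho' B ->
  (forall y, 0 < y < rho' -> A y < B y) ->
  (forall y, 0 < y < rho' -> exists2 p, sigma p & p.2 = y) ->
  upper_part sigma rho' p0 ->
  exists s : nat -> R * R, [/\ s 0%N = p0, forall k, upper_part sigma rho' (s k) &
    forall k, B (s k.+1).2 = A (s k).2].
Proof.
move=> pA pB AB hit [sp0 p0r].
have [y [y0 yr yE]] := step_orbit pA pB AB p0r.
have /choice[pt Hpt] k : exists p, sigma p /\ p.2 = y k.
  by have [p sp py] := hit _ (yr k); exists p.
pose s k := if k is 0%N then p0 else pt k.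
have s2 k : (s k).2 = y k.
  by case: k => [|k]; [rewrite y0|have [] := Hpt k.+1].
exists s; split=> [//|k|k]; last by rewrite !s2 yE.
split; last by rewrite s2.
by case: k => // k; have [] := Hpt k.+1.
Qed.

(** [(A, B)] stands for [(J, L)] or [(L, J)] according to the sign of the integral; in both cases
    [B - A] is its absolute value. *)
Lemma orbit_codim (sigma : set (R * R)) (rho' K : R) (A B : R -> R)
    (s : nat -> R * R) : rho' <= rho -> 0 <= K ->
  (forall p q, upper_part sigma rho' p -> upper_part sigma rho' q ->
    `|p.1 - q.1| <= K * `|p.2 - q.2|) ->
  bilipschitz_profile rho' A -> bilipschitz_profile rho' B ->
  (forall y, 0 < y < rho' -> A y < B y) ->
  (forall y, 0 < y < rho' -> B y - A y = `|J y - L y|) ->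
  (forall k, upper_part sigma rho' (s k)) ->
  (forall k, B (s k.+1).2 = A (s k).2) ->
  exists2 d, has_box_dim (range s) d & codim_of_dim d c.
Proof.
move=> rr K0 lip pA pB AB absE us E.
have hs k : 0 < (s k).2 < rho' by have [] := us k.
have step k := step_gap pB AB (hs k) (hs k.+1) (E k).
apply: (dims K0).
- by move=> k k'; exact: lip.
- by move=> k; have /andP[-> /lt_le_trans] := hs k; apply.
- by move=> k; have [] := step k.
- exact: (step_cvg0 pA pB AB hs E).
- by move=> k; have [_] := step k; rewrite absE.
Qed.

(** The section enters only through its Lipschitz constant and the heights it reaches; the
    codimension enters only through [dims], which turns gaps comparable to |J - L| into a
    dimension. *)
Lemma fractal_codim_of_profile : fractal_codim F c.
Proof.
move=> sigma sec.
have [rho1 rho10 [K K0 [hit1 lip1]]] := transverse_lipschitz_graph sec.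
near=> rho'.
have r'0 : 0 < rho' by near: rho'; exact: nbhs_right_gt.
have r'r : rho' <= rho by near: rho'; apply: nbhs_right_le.
have r'1 : rho' <= rho1 by near: rho'; apply: nbhs_right_le.
have inr y : 0 < y < rho' -> 0 < y < rho.
  by move=> /andP[-> /lt_le_trans]; apply.
have hit y : 0 < y < rho' -> exists2 p, sigma p & p.2 = y.
  by move=> /andP[y0 yr]; apply: hit1; rewrite y0 (lt_le_trans yr).
have up1 p : upper_part sigma rho' p -> upper_part sigma rho1 p.
  by move=> [sp /andP[p0 pr]]; split=> //; rewrite p0 (lt_le_trans pr).
have lip p q : upper_part sigma rho' p -> upper_part sigma rho' q ->
    `|p.1 - q.1| <= K * `|p.2 - q.2|.
  by move=> /up1 up /up1 uq; exact: lip1.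
have pJ' := profile_restrict r'r pJ; have pL' := profile_restrict r'r pL.
have dE p q : upper_part sigma rho' p -> upper_part sigma rho' q ->
    slow_divergence F p q = J q.2 - L p.2.
  by move=> [_ pr] [_ qr]; apply: divE; exact: inr.
split.
  by move=> p up; rewrite dE//; apply: div_neq0; apply: inr; case: up.
move=> p0 up0.
have [lt|lt] := profile_gap_sign pJ' pL' (fun y yr => div_neq0 (inr y yr)).
- split.
    have [s [s0 us E]] := orbit_on_section pJ' pL' lt hit up0.
    exists s; split=> //; left; split=> [q uq|k].
      by rewrite dE// subr_lt0; apply: lt; case: uq.
    by rewrite dE// E subrr.
  (* The sign of the integral at [p0] rules out the other alternative in [slow_orbit]. *)
  move=> s [s0 us [[_ E]|[pos _]]]; last first.
    have := pos _ up0; rewrite dE// subr_gt0 => Lp; have [_ /lt] := up0.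
    by rewrite ltNge (ltW Lp).
  apply: (orbit_codim r'r K0 lip pJ' pL' lt _ us).
    by move=> y yr; rewrite distrC gtr0_norm// subr_gt0 lt.
  by move=> k; have /eqP := E k; rewrite dE// subr_eq0 => /eqP.
- split.
    have [s [s0 us E]] := orbit_on_section pL' pJ' lt hit up0.
    exists s; split=> //; right; split=> [q uq|k].
      by rewrite dE// subr_gt0; apply: lt; case: uq.
    by rewrite dE// E subrr.
  move=> s [s0 us [[neg _]|[_ E]]].
    have := neg _ up0; rewrite dE// subr_lt0 => Lp; have [_ /lt] := up0.
    by rewrite ltNge (ltW Lp).
  apply: (orbit_codim r'r K0 lip pL' pJ' lt _ us).
    by move=> y yr; rewrite gtr0_norm// subr_gt0 lt.
  by move=> k; have /eqP := E k; rewrite dE// subr_eq0 => /eqP.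
Unshelve. all: by end_near. Qed.

End FractalCodimension.

(** * Size of the slow divergence integral in finite and infinite codimension *)

(** The power bound increases with x, so its value at [z] is a bound on all of [[0, z]], as the
    integration by parts requires. *)
Lemma odd_part_small {R : realType} (F g : R -> R) (z B : R) (n : nat) :
  0 <= B -> (forall x, 0 <= x <= z -> F x - F (- x) = - x ^+ 3 * g x) ->
  (forall x, 0 <= x <= z -> `|g x| <= B * x ^+ n) ->
  forall x, 0 <= x <= z -> `|F x - F (- x)| <= B * z ^+ (n + 3).
Proof.
move=> B0 FE gB x xz; have /andP[x0 xz'] := xz.
have z0 : 0 <= z by exact: le_trans xz'.
rewrite FE// normrM normrN normrX (ger0_norm x0).
apply: (@le_trans _ _ (x ^+ 3 * (B * x ^+ n))).
  by apply: ler_wpM2l; [rewrite exprn_ge0|exact: gB].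
rewrite mulrCA -exprD addnC; apply: ler_wpM2l => //.
by apply: lerXn2r; rewrite ?nnegrE.
Qed.

(* g x stands for h x + h (- x), z for - alpha_pt y and I for the slow
   divergence integral at height y; the last hypothesis is the conclusion of
   germ_divergence. *)
Lemma divergence_finite {R : realType} (M z I alpha K : R) (F g : R -> R)
    (j : nat) : 0 <= M -> 0 <= K -> 0 < z -> alpha != 0 ->
  (forall x, 0 <= x <= z -> F x - F (- x) = - x ^+ 3 * g x) ->
  (forall x, 0 <= x <= z -> `|g x - alpha * x ^+ (2 * j)| <= K * x ^+ (2 * j + 2)) ->
  K * z ^+ 2 <= `|alpha| / 2 -> 24 * M * z <= 1 ->
  (forall B, (forall x, 0 <= x <= z -> `|F x - F (- x)| <= B) ->
    `|I - 2 * (F z - F (- z))| <= 3 / 2 * `|F z - F (- z)| + 2 * M * B * z) ->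
  `|alpha| / 8 * z ^+ (2 * j + 3) <= `|I| <= 6 * `|alpha| * z ^+ (2 * j + 3).
Proof.
move=> M0 K0 z0 alpha0 FE gE Kz Mz HI.
set a := `|alpha| in Kz *; have a0 : 0 < a by rewrite normr_gt0.
have zz : 0 <= z <= z by rewrite lexx ltW.
have gdev x : 0 <= x <= z -> `|g x - alpha * x ^+ (2 * j)| <= a / 2 * x ^+ (2 * j).
  move=> xz; apply: le_trans (gE _ xz) _; rewrite exprD mulrCA mulrC.
  have /andP[x0 xz'] := xz.
  apply: ler_wpM2r; first by rewrite exprn_ge0.
  apply: le_trans Kz; apply: ler_wpM2l => //.
  by apply: lerXn2r; rewrite ?nnegrE// ltW.
have up x : 0 <= x <= z -> `|g x| <= 3 / 2 * a * x ^+ (2 * j).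
  move=> xz; have := gdev _ xz; have /andP[x0 _] := xz.
  have := ler_normD (g x - alpha * x ^+ (2 * j)) (alpha * x ^+ (2 * j)).
  by rewrite subrK normrM normrX (ger0_norm x0) -/a; lra.
have subK (u v : R) : u - (u - v) = v by ring.
have lo : a / 2 * z ^+ (2 * j) <= `|g z|.
  have := gdev _ zz.
  have := ler_normB (g z) (g z - alpha * z ^+ (2 * j)).
  by rewrite subK normrM normrX (ger0_norm (ltW z0)) -/a; lra.
have B0 : 0 <= 3 / 2 * a by lra.
have DB := odd_part_small B0 FE up.
have := HI _ DB.
have DE : `|F z - F (- z)| = z ^+ 3 * `|g z|.
  by rewrite FE// normrM normrN normrX (ger0_norm (ltW z0)).
have Dup := DB z zz.
have Dlo : a / 2 * z ^+ (2 * j + 3) <= `|F z - F (- z)|.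
  rewrite DE exprD mulrA [X in _ <= X]mulrC.
  by apply: ler_wpM2r => //; rewrite exprn_ge0// ltW.
set D := F z - F (- z) in Dup Dlo *; set Z := z ^+ (2 * j + 3) in Dup Dlo *.
have Z0 : 0 <= Z by rewrite exprn_ge0// ltW.
(* The constant 24 brings the remainder to [a Z / 8]. As |D| is at least [a Z / 2], the lower bound
   is |D|/2 minus this, at least [a Z / 8]; the upper bound is [(7/2)(3/2) + 1/8 <= 6] times
   [a Z]. *)
have err : 2 * M * (3 / 2 * a * Z) * z <= a / 8 * Z.
  have -> : 2 * M * (3 / 2 * a * Z) * z = (24 * M * z) * (a / 8 * Z) by field.
  by apply: ler_piMl => //; apply: mulr_ge0 => //; lra.
move=> HD.
have h1 := ler_normD (I - 2 * D) (2 * D).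
have h2 := ler_normB I (I - 2 * D).
move: h1 h2; rewrite subrK subK normrM (ger0_norm (ler0n _ 2)).
by move=> h1 h2; apply/andP; split; lra.
Qed.

(** Raise [4/5 y <= z^2 <= 4/3 y] to the power m/2; [m = 2j + 3] produces the exponent
    [mu = j + 3/2]. *)
Lemma height_power {R : realType} (y z : R) (m : nat) : 0 < z ->
  3 / 4 * z ^+ 2 <= y <= 5 / 4 * z ^+ 2 ->
  (4 / 5) `^ (m%:R / 2) * y `^ (m%:R / 2) <= z ^+ m
    <= (4 / 3) `^ (m%:R / 2) * y `^ (m%:R / 2).
Proof.
move=> z0 /andP[y1 y2]; have z20 : 0 < z ^+ 2 by rewrite exprn_gt0.
have y0 : 0 <= y by lra.
have zm : z ^+ m = (z ^+ 2) `^ (m%:R / 2).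
  rewrite -[z ^+ 2]powR_mulrn ?(ltW z0)// -powRrM mulrC divfK ?pnatr_eq0//.
  by rewrite powR_mulrn// ltW.
have m0 : 0 <= m%:R / 2 :> R by rewrite divr_ge0.
have c1 : (0 : R) <= 4 / 5 by lra.
have c2 : (0 : R) <= 4 / 3 by lra.
rewrite -(powRM _ c1 y0) -(powRM _ c2 y0) zm.
by apply/andP; split; apply: ge0_ler_powR; rewrite ?nnegrE; lra.
Qed.

Lemma near0_interval {R : realType} (P : R -> Prop) :
  (\forall x \near (0:R), P x) ->
  exists2 b : R, 0 < b & forall x, 0 <= x < b -> P x.
Proof.
move=> /nbhs_ballP[b /= b0 bP]; exists b => // x /andP[x0 xb].
by apply: bP; rewrite /ball/= sub0r normrN ger0_norm.
Qed.

Section CriticalFunction.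
Context {R : realType} {l : nat} (h1 : R -> R -> 'rV[R]_l -> R)
  (lam0 : 'rV[R]_l).
Hypothesis h1_smooth : smooth_h1 h1 lam0.

Notation F := (critical_fun h1 lam0).

Lemma critical_fun_odd_part (x : R) :
  F x - F (- x) = - x ^+ 3 * (h1 x 0 lam0 + h1 (- x) 0 lam0).
Proof. by rewrite /critical_fun; ring. Qed.

Lemma critical_profile : exists (rho M : R) (J L Z : R -> R),
  [/\ 0 < rho, 0 <= M, bilipschitz_profile rho J, bilipschitz_profile rho L &
   (forall p q, 0 < p.2 < rho -> 0 < q.2 < rho ->
      slow_divergence F p q = J q.2 - L p.2) /\
   (forall y, 0 < y < rho ->
      [/\ 0 < Z y, 3 / 4 * Z y ^+ 2 <= y <= 5 / 4 * Z y ^+ 2 & forall B,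
       (forall x, 0 <= x <= Z y -> `|F x - F (- x)| <= B) ->
       `|J y - L y - 2 * (F (Z y) - F (- Z y))| <=
         3 / 2 * `|F (Z y) - F (- Z y)| + 2 * M * B * Z y])].
Proof.
have [a a0 [H Hh dH]] := smooth_slice h1_smooth.
have FE x : `|x| < a -> F x = x ^+ 2 - x ^+ 3 * H 0%N x.
  by move=> xa; rewrite Hh.
have [r [M [G [dG [P [_ germ]]]]]] := contact_germ_exists a0 FE dH.
have M0 : 0 <= M.
  have [r0 _ _ g] := germ; have [|_ _ _ _] := g 0; first by rewrite normr0.
  exact: le_trans.
have [rho [J [L [Z [rho0 pJ pL dE est]]]]] := divergence_profile germ.
exists rho, M, J, L, Z; split; [exact: rho0|exact: M0|exact: pJ|exact: pL|].
split; first exact: dE.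
by move=> y /est[/andP[Z0 _] ? ?]; split.
Qed.

Lemma finite_codim_fractal (j : nat) : even_part_order h1 lam0 j ->
  fractal_codim F (Some j.+1).
Proof.
move=> /even_part_orderP[alpha alpha0 [K HK]].
have [b b0 Hb] := near0_interval HK.
have [rho [M [J [L [Z [rho0 M0 pJ pL [dE est]]]]]]] := critical_profile.
have a0 : 0 < `|alpha| by rewrite normr_gt0.
set a := `|alpha| in a0.
have K0 := normr_ge0 K.
(* In this order: validity of the expansion of the even part, [z^2 <= z], and the two smallness
   conditions of [divergence_finite]. The added ones keep the denominators positive. *)
pose z1 := Num.min (Num.min (b / 2) 1) (Num.min (a / (2 * (`|K| + 1))) (24 * (M + 1))^-1).
have z10 : 0 < z1.
  by rewrite !lt_min divr_gt0 ?ltr01 ?invr_gt0 ?divr_gt0 ?mulr_gt0//; lra.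
have [z1b z11 z1a z1M] : [/\ z1 <= b / 2, z1 <= 1, z1 <= a / (2 * (`|K| + 1)) &
    z1 <= (24 * (M + 1))^-1].
  by have : z1 <= z1 by []; rewrite {2}/z1 !le_min => /andP[/andP[? ?] /andP[? ?]].
pose mu : R := (2 * j + 3)%:R / 2.
have mu1 : 1 < mu.
  by rewrite /mu natrD natrM; have : (0 : R) <= j%:R by []; lra.
(* Since [3/4 (Z y)^2 <= y], heights below [3/4 z1^2] have [Z y < z1]. *)
pose rho' := Num.min rho (3 / 4 * z1 ^+ 2).
have rho'0 : 0 < rho'.
  by rewrite lt_min rho0 mulr_gt0// ?exprn_gt0//; lra.
have rr : rho' <= rho by rewrite ge_min lexx.
pose c : R := a / 8 * (4 / 5) `^ mu; pose C : R := 6 * a * (4 / 3) `^ mu.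
have c0 : 0 < c by rewrite mulr_gt0 ?powR_gt0//; lra.
have C0 : 0 < C by rewrite mulr_gt0 ?powR_gt0//; lra.
have key y : 0 < y < rho' -> c * y `^ mu <= `|J y - L y| <= C * y `^ mu.
  rewrite lt_min => /andP[y0 /andP[yr y1]].
  have [|Z0 Zy HI] := est y; first by rewrite y0.
  have Zz1 : Z y < z1.
    rewrite -(@ltr_pXn2r _ 2) ?nnegrE ?(ltW Z0) ?(ltW z10)//; lra.
  have inb x : 0 <= x <= Z y -> 0 <= x < b by move=> /andP[? ?]; apply/andP; split; lra.
  have gE x : 0 <= x <= Z y ->
      `|h1 x 0 lam0 + h1 (- x) 0 lam0 - alpha * x ^+ (2 * j)| <= `|K| * x ^+ (2 * j + 2).
    move=> xZ; have /andP[x0 _] := xZ.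
    apply: le_trans (Hb _ (inb _ xZ)) _; rewrite (ger0_norm x0).
    by apply: ler_wpM2r; [exact: exprn_ge0|exact: ler_norm].
  have KZ : `|K| * Z y ^+ 2 <= `|alpha| / 2.
    have h : z1 * (2 * (`|K| + 1)) <= a by rewrite -ler_pdivlMr//; lra.
    have h2 : `|K| * Z y ^+ 2 <= `|K| * z1.
      apply: ler_wpM2l => //; rewrite expr2.
      apply: (@le_trans _ _ (Z y * 1)); last by lra.
      by apply: ler_wpM2l; lra.
    by rewrite -/a; nra.
  have MZ : 24 * M * Z y <= 1.
    have h : z1 * (24 * (M + 1)) <= 1 by rewrite -ler_pdivlMr ?mul1r//; lra.
    have h2 : M * Z y <= M * z1 by apply: ler_wpM2l => //; exact: ltW.
    by nra.
  have /andP[lo up] := divergence_finite M0 K0 Z0 alpha0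
    (fun x _ => critical_fun_odd_part x) gE KZ MZ HI.
  have /andP[p1 p2] := height_power (2 * j + 3) Z0 Zy.
  apply/andP; split.
  - apply: le_trans lo; rewrite /c -[_ * _ * y `^ mu]mulrA; apply: ler_wpM2l; last exact: p1.
    by rewrite -/a; lra.
  - apply: le_trans up _; rewrite /C -[_ * _ * y `^ mu]mulrA; apply: ler_wpM2l; last exact: p2.
    by rewrite -/a; lra.
apply: (@fractal_codim_of_profile R F rho' J L).
- exact: rho'0.
- exact: profile_restrict pJ.
- exact: profile_restrict pL.
- move=> p q /andP[p0 pr] /andP[q0 qr]; apply: dE.
    by rewrite p0 (lt_le_trans pr).
  by rewrite q0 (lt_le_trans qr).
- move=> y yr; rewrite -normr_gt0.
  have /andP[lo _] := key _ yr; apply: lt_le_trans lo.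
  by rewrite mulr_gt0// powR_gt0//; case/andP: yr.
move=> s K' K'0 lip sr dec cvg0 gap.
have s0 k : 0 < (s k).2 by have /andP[] := sr k.
have c'0 : 0 < 2 / 5 * c by lra.
have C'0 : 0 < 2 / 3 * C by lra.
exists (1 - mu^-1).
  apply: (has_box_dim_of_gaps K'0 lip s0 dec cvg0 mu1 c'0 C'0) => k.
  have /andP[g1 g2] := gap k; have /andP[k1 k2] := key _ (sr k).
  by apply/andP; split; lra.
have muE : mu^-1 = 2 / (2 * j%:R + 3) by rewrite /mu natrD natrM invf_div.
have j0 : (0 : R) <= j%:R by [].
have mui : 0 < mu^-1 by rewrite invr_gt0; lra.
split; first by lra.
(* With [d = 1 - 2/(2j+3)], [3d - 1 = 4j/(2j+3)] and [2(1 - d) = 4/(2j+3)], whose quotient is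
   [j]. *)
exists j; split=> //; rewrite muE; field.
by apply/andP; split; apply/eqP; lra.
Qed.

Lemma infinite_codim_fractal (sigma : set (R * R)) : infinite_codim h1 lam0 ->
  transverse_section F sigma ->
  (\forall rho \near (0 : R)^'+, divergence_nonzero F (upper_part sigma rho)) ->
  fractal_codim F None.
Proof.
move=> flat sec nz.
have [rho [M [J [L [Z [rho0 M0 pJ pL [dE est]]]]]]] := critical_profile.
have [rho1 rho10 [K1 _ [hit _]]] := transverse_lipschitz_graph sec.
have [rho' [rho'0 rr r1 nz']] : exists rho', [/\ 0 < rho', rho' <= rho,
    rho' <= rho1 & divergence_nonzero F (upper_part sigma rho')].
  have : \forall rho' \near (0:R)^'+, [/\ 0 < rho', rho' <= rho,
    rho' <= rho1 & divergence_nonzero F (upper_part sigma rho')].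
    near=> rho'; split.
    - by near: rho'; exact: nbhs_right_gt.
    - by near: rho'; exact: nbhs_right_le.
    - by near: rho'; exact: nbhs_right_le.
    - by near: rho'.
  exact: filter_ex.
have dE' p q : 0 < p.2 < rho' -> 0 < q.2 < rho' ->
    slow_divergence F p q = J q.2 - L p.2.
  move=> /andP[p0 pr] /andP[q0 qr]; apply: dE.
    by rewrite p0 (lt_le_trans pr).
  by rewrite q0 (lt_le_trans qr).
have small mu : exists2 C : R, 0 < C & exists2 y1 : R, 0 < y1 &
    forall y, 0 < y < rho -> y < y1 -> `|J y - L y| <= C * y `^ mu.
  (* Flatness to order 2N makes the integral [O(z^(2N))], that is [O(y^N)], which is at most a
     constant times [y^mu] for [y < 1]. *)
  pose N := (Num.truncn mu).+1.
  have muN : mu <= N%:R by apply: ltW; exact: truncnS_gt.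
  have [K HK] := flat_even_part N h1_smooth flat.
  have [b b0 Hb] := near0_interval HK.
  have K0 := normr_ge0 K.
  pose z1 := Num.min (b / 2) 1.
  have z10 : 0 < z1 by rewrite lt_min ltr01 andbT; lra.
  have z1b : z1 <= b / 2 by rewrite ge_min lexx.
  have z11 : z1 <= 1 by rewrite ge_min lexx orbT.
  pose A := 7 / 2 * `|K| + 2 * M * `|K| + 1.
  have MK : 0 <= M * `|K| by exact: mulr_ge0.
  have A0 : 0 < A by rewrite /A; lra.
  exists (A * (4 / 3) `^ N%:R); first by rewrite mulr_gt0// powR_gt0//; lra.
  exists (3 / 4 * z1 ^+ 2); first by rewrite mulr_gt0// ?exprn_gt0//; lra.
  move=> y yr yz1; have [Z0 Zy HI] := est _ yr.
  have /andP[y0 _] := yr.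
  have Zz1 : Z y < z1.
    rewrite -(@ltr_pXn2r _ 2) ?nnegrE ?(ltW Z0) ?(ltW z10)//; lra.
  have gB x : 0 <= x <= Z y ->
      `|h1 x 0 lam0 + h1 (- x) 0 lam0| <= `|K| * x ^+ (2 * N).
    move=> /andP[x0 xZ]; apply: le_trans (Hb x _) _; first by apply/andP; split; lra.
    rewrite (ger0_norm x0).
    by apply: ler_wpM2r; [exact: exprn_ge0|exact: ler_norm].
  have DB := odd_part_small K0 (fun x _ => critical_fun_odd_part x) gB.
  have zz : 0 <= Z y <= Z y by rewrite lexx ltW.
  have := HI _ DB; have := DB _ zz.
  set D := F (Z y) - F (- Z y) => D1 I1.
  pose w := Z y ^+ (2 * N).
  have w0 : 0 <= w by rewrite exprn_ge0// ltW.
  have zN : `|K| * Z y ^+ (2 * N + 3) <= `|K| * w.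
    apply: ler_wpM2l => //; rewrite exprD -[leRHS]mulr1; apply: ler_wpM2l => //.
    by apply: exprn_ile1; lra.
  have Iw : `|J y - L y| <= A * w.
    have := ler_normD (J y - L y - 2 * D) (2 * D).
    rewrite subrK normrM (ger0_norm (ler0n _ 2)).
    have e1 : 2 * M * (`|K| * Z y ^+ (2 * N + 3)) * Z y <= 2 * M * (`|K| * w).
      rewrite -[leRHS]mulr1; apply: ler_pM => //; last by lra.
      - by rewrite !mulr_ge0// exprn_ge0// ltW.
      - exact: ltW.
      - by apply: ler_wpM2l => //; lra.
    have A' : A * w = 7 / 2 * (`|K| * w) + 2 * M * (`|K| * w) + w by rewrite /A; ring.
    by rewrite A'; lra.
  apply: le_trans Iw _; rewrite -[_ * _ * y `^ mu]mulrA; apply: ler_wpM2l; first exact: ltW.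
  have /andP[_] := height_power (2 * N) Z0 Zy.
  have -> : (2 * N)%:R / 2 = N%:R :> R by rewrite natrM mulrC mulKf// pnatr_eq0.
  rewrite -/w => /le_trans; apply; apply: ler_wpM2l; first exact: powR_ge0.
  apply: ger_powR => //; rewrite y0/=.
  have : z1 ^+ 2 <= 1 by apply: exprn_ile1; lra.
  by lra.
apply: (@fractal_codim_of_profile R F rho' J L).
- exact: rho'0.
- exact: profile_restrict pJ.
- exact: profile_restrict pL.
- exact: dE'.
- move=> y yr; have /andP[y0 yr'] := yr.
  (* The given section has a point at each small height, so nonvanishing there yields [J y != L y],
     a statement free of [sigma]. *)
  have [|p sp py] := hit y; first by rewrite y0 (lt_le_trans yr').
  have py' : 0 < p.2 < rho' by rewrite py.
  have := nz' p; rewrite (dE' _ _ py' py') py; apply.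
  by split=> //; rewrite py.
move=> s K' K'0 lip sr dec cvg0 gap; exists 1 => //.
have s0 k : 0 < (s k).2 by have /andP[] := sr k.
apply: (has_box_dim1_of_gaps K'0 lip s0 dec cvg0) => mu _.
have [C C0 [y1 y10 HC]] := small mu.
exists C => //; exists y1 => // k ky1.
have /andP[_ g2] := gap k; apply: le_trans g2 _.
have sk : 0 < (s k).2 < rho.
  by have /andP[-> /lt_le_trans] := sr k; apply.
have := HC _ sk ky1.
by have := normr_ge0 (J (s k).2 - L (s k).2); lra.
Unshelve. all: by end_near. Qed.

End CriticalFunction.

Theorem lemma3p3 (R : realType) (l : nat)
    (h1 : R -> R -> 'rV[R]_l -> R) (b : R -> 'rV[R]_l -> R) (lam0 : 'rV[R]_l)
    (h1_smooth : smooth_h1 h1 lam0) (b_smooth : smooth_b b lam0)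
    (b0 : b 0 lam0 = 0) :
  (forall j : nat, finite_codim h1 lam0 j.+1 ->
     fractal_codim (critical_fun h1 lam0) (Some j.+1)) /\
  (infinite_codim h1 lam0 ->
   forall sigma : set (R * R),
     transverse_section (critical_fun h1 lam0) sigma ->
     (\forall rho \near (0 : R)^'+,
        divergence_nonzero (critical_fun h1 lam0) (upper_part sigma rho)) ->
     fractal_codim (critical_fun h1 lam0) None).
Proof.
split=> [j [_ [<-]]|flat sigma sec nz]; first exact: finite_codim_fractal.
exact: infinite_codim_fractal flat sec nz.
Qed.
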